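(* Let $G=(V,E)$ be a finite simple graph with a maximal adjacency ordering $<$, with vertices identified with $1,\dots,n$ according to $<$; let $m=|E|$. Let $s>1$ be a vertex and $k$ a positive integer at most the number of neighbours of $s$ in $\{1,\dots,s-1\}$. For $i\in\{1,\dots,k\}$ let $T_i$ be the connected component of the forest $(V,F_i)$ containing $s$. Let $t<s$ be a vertex of $T_k$. Then $k$ internally vertex-disjoint paths between $s$ and $t$ can be computed in time $O(|E(T_1\cup\dots\cup T_k)|)\subseteq O(n+m)$.
   Context: A maximal adjacency ordering (MAO) of $G$ is a total order $1,\dots,n$ on $V$ such that for every two vertices $v<w$, the number of neighbours of $v$ in $\{1,\dots,v-1\}$ is at least the number of neighbours of $w$ in $\{1,\dots,v-1\}$. Forest decomposition: for each vertex $v>1$ with neighbours $w_1<\dots<w_l$ in $\{1,\dots,v-1\}$, the edge $\{w_i,v\}$ is put into the edge set $F_i$ for $i=1,\dots,l$; each $(V,F_i)$ is a forest. *)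

(* Defs.v *)
From mathcomp Require Import all_boot.

Set Implicit Arguments.
Unset Strict Implicit.
Unset Printing Implicit Defensive.

(* Plain MathComp.  A graph with a maximal adjacency ordering lives on 'I_n,
   the ordering being the order of 'I_n; the vertex called v in 1, ..., n is the
   ordinal of value v - 1. *)

Section Graphs.

Variables (n : nat) (e : rel 'I_n).

Definition simple_graph : Prop := symmetric e /\ irreflexive e.

Definition nb_before (v w : 'I_n) : nat := #|[set u : 'I_n | (u < v) && e u w]|.

Definition max_adj_ordering : Prop :=
  forall v w : 'I_n, v < w -> nb_before v w <= nb_before v v.

(* [enum 'I_n] is increasing, hence so are the next two lists. *)
Definition neighbours (v : 'I_n) : seq 'I_n := [seq w <- enum 'I_n | e v w].

Definition left_neighbours (v : 'I_n) : seq 'I_n :=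
  [seq w : 'I_n <- neighbours v | w < v].

(* w = w_i, where w_1 < ... < w_l are the left neighbours of v; i starts at 1. *)
Definition is_left_neighbour (i : nat) (v w : 'I_n) : bool :=
  (w \in left_neighbours v) && ((index w (left_neighbours v)).+1 == i).

(* Adjacency in the forest (V, F_i). *)
Definition forest (i : nat) : rel 'I_n :=
  [rel u v | is_left_neighbour i v u || is_left_neighbour i u v].

Definition edges (r : rel 'I_n) : {set {set 'I_n}} :=
  [set [set p.1; p.2] | p : 'I_n * 'I_n & r p.1 p.2].

Definition tree_vertices (i : nat) (s : 'I_n) : {set 'I_n} :=
  [set v | connect (forest i) s v].

Definition tree_edges (i : nat) (s : 'I_n) : {set {set 'I_n}} :=
  [set f in edges (forest i) | f \subset tree_vertices i s].

(* The edge set of T_1 :|: ... :|: T_k. *)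
Definition union_tree_edges (k : nat) (s : 'I_n) : {set {set 'I_n}} :=
  \bigcup_(i < k) tree_edges i.+1 s.

Definition is_path_between (s t : 'I_n) (p : seq 'I_n) : bool :=
  if p is x :: q then [&& x == s, path e x q, last x q == t & uniq p]
  else false.

(* [uniq ps] matters: an edge between s and t is a path without internal
   vertices, and may be used only once. *)
Definition internally_disjoint_paths (s t : 'I_n) (ps : seq (seq 'I_n)) : Prop :=
  [/\ uniq ps,
      forall p, p \in ps -> is_path_between s t p &
      forall p q, p \in ps -> q \in ps -> p != q ->
        forall x, x \in p -> x \in q -> x = s \/ x = t].

End Graphs.

(* The model of computation is a word RAM without multiplication, programmed in
   a while language.  The memory consists of arrays, of which a fixed program
   names finitely many; interleaving them gives the usual single memory.  A
   scalar variable is the cell 0 of an array.  Words have w bits: additions and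
   constants are reduced modulo 2 ^ w, and subtraction is truncated at 0. *)

Definition state := nat -> nat -> nat.

Inductive expr : Type :=
| Const of nat
| Cell of nat & expr
| Add of expr & expr
| Sub of expr & expr.

Fixpoint eval (w : nat) (m : state) (x : expr) : nat :=
  match x with
  | Const c => c %% 2 ^ w
  | Cell a y => m a (eval w m y)
  | Add y z => (eval w m y + eval w m z) %% 2 ^ w
  | Sub y z => eval w m y - eval w m z
  end.

Fixpoint expr_cost (x : expr) : nat :=
  match x with
  | Const _ => 1
  | Cell _ y => (expr_cost y).+1
  | Add y z | Sub y z => (expr_cost y + expr_cost z).+1
  end.

Inductive program : Type :=
| Skip
| Store of nat & expr & expr
| Seq of program & program
| If of expr & program & program
| While of expr & program.

Definition update (m : state) (a j v : nat) : state :=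
  fun a' j' => if (a' == a) && (j' == j) then v else m a' j'.

(* [exec w p m T m']: started in m, the program p halts in m' after time T.
   A test succeeds when its value is nonzero. *)
Inductive exec (w : nat) : program -> state -> nat -> state -> Prop :=
| ExecSkip m :
    exec w Skip m 1 m
| ExecStore a x y m :
    exec w (Store a x y) m (expr_cost x + expr_cost y).+1
      (update m a (eval w m x) (eval w m y))
| ExecSeq p q m1 m2 m3 T1 T2 :
    exec w p m1 T1 m2 -> exec w q m2 T2 m3 ->
    exec w (Seq p q) m1 (T1 + T2) m3
| ExecIfTrue x p q m m' T :
    eval w m x != 0 -> exec w p m T m' ->
    exec w (If x p q) m (expr_cost x + T).+1 m'
| ExecIfFalse x p q m m' T :
    eval w m x = 0 -> exec w q m T m' ->
    exec w (If x p q) m (expr_cost x + T).+1 m'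
| ExecWhileTrue x p m1 m2 m3 T1 T2 :
    eval w m1 x != 0 -> exec w p m1 T1 m2 -> exec w (While x p) m2 T2 m3 ->
    exec w (While x p) m1 (expr_cost x + T1 + T2).+1 m3
| ExecWhileFalse x p m :
    eval w m x = 0 ->
    exec w (While x p) m (expr_cost x).+1 m.

(* A list of rows is stored as the concatenation of the rows, together with the
   position at which each row starts, and the total length at the end. *)
Definition offsets (rows : seq (seq nat)) : seq nat :=
  [seq sumn (take i (shape rows)) | i <- iota 0 (size rows).+1].

Definition stores_rows (m : state) (a b : nat) (rows : seq (seq nat)) : Prop :=
  (forall i, i < size (offsets rows) -> m a i = nth 0 (offsets rows) i) /\
  (forall j, j < size (flatten rows) -> m b j = nth 0 (flatten rows) j).

Definition vertex_rows n (ps : seq (seq 'I_n)) : seq (seq nat) :=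
  [seq [seq val v | v <- p] | p <- ps].

(* Array 0 holds n, s, t, k; arrays 1 and 2 hold the adjacency lists, sorted
   by the ordering, so that the i-th entry of the row of v is, as long as it is
   smaller than v, the neighbour of v through an edge of F_i.  All other cells
   are 0. *)
Definition input n (e : rel 'I_n) (s t : 'I_n) (k : nat) : state :=
  let rows := vertex_rows [seq neighbours e v | v <- enum 'I_n] in
  fun a j =>
    nth 0 (nth [::] [:: [:: n; val s; val t; k]; offsets rows; flatten rows] a) j.

(* The paths are written to arrays 3 and 4, each as its sequence of vertices. *)
Definition outputs n (m : state) (ps : seq (seq 'I_n)) : Prop :=
  stores_rows m 3 4 (vertex_rows ps).

(* Main.v *)
(* Sweep the vertices v from s down to the left, maintaining the set A of current
   ends of the k paths from s (at first the k leftmost neighbours of s) and, once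
   v has passed t, the set B of current ends of the paths from t (at first the
   leftmost neighbours of t). Below v both sets have the same size j. If v lies
   in both, a path from s meets a path from t, and j drops. If v lies in A only,
   that path advances to the largest of the first j left neighbours of v outside
   A, and similarly for B. Such a neighbour exists: by maximality of the ordering,
   v has at least as many left neighbours as there are ends of either kind to its
   left, and choosing the largest one preserves this property. It also keeps the
   end of rank i in T_i, so that the first j left edges of v lie in T_1, ..., T_k
   and pay for the work done at v. The pointers left behind form a partial
   injection, and following it from the neighbours of s yields the paths. *)

Require Import Defs.
From mathcomp Require Import all_boot zify.

Set Implicit Arguments.
Unset Strict Implicit.
Unset Printing Implicit Defensive.

(** * Executions with a time bound *)

(** All links point towards [t]: an end of a path from [s] stores the vertex it advances to, whereas
    a vertex reached by a path from [t] stores the vertex it was reached from. Hence a meeting needs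
    no splicing: the link already stored at the meeting vertex continues the path. Vertices are
    never removed from either set of ends, so advancing outside the set keeps paths of the same kind
    apart. The time bound is delicate because the sweep also visits vertices that are ends of no
    path. The invariant [good] therefore speaks of every vertex up to the sweep position: it has at
    least as many left neighbours as there are ends before it, and it lies in the tree whose index
    is that number. As the vertex sets of the trees decrease with the index, the first left edges of
    each visited vertex belong to the union and can be charged. *)

Section Runs.

Variable w : nat.

Lemma eval_ext (m m' : state) (x : expr) : m =2 m' -> eval w m x = eval w m' x.
Proof.
move=> eqm; elim: x => [c|a y IHy|y IHy z IHz|y IHy z IHz] //=.
- by rewrite IHy eqm.
- by rewrite IHy IHz.
- by rewrite IHy IHz.
Qed.

(* States are functions, hence compared pointwise. *)
Definition runs (p : program) (m : state) (B : nat) (m' : state) : Prop :=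
  forall m0, m0 =2 m ->
  exists T m1, [/\ exec w p m0 T m1, T <= B & m1 =2 m'].

Lemma runs_weaken p m B B' m' m'' :
  runs p m B m' -> B <= B' -> m' =2 m'' -> runs p m B' m''.
Proof.
move=> run leB eqm m0 /run[T [m1 [ex leT eqm1]]]; exists T, m1; split=> //.
  exact: leq_trans leB.
by move=> a c; rewrite eqm1 eqm.
Qed.

Lemma runs_pre p m m' B m'' : m =2 m' -> runs p m' B m'' -> runs p m B m''.
Proof. by move=> eqm run m0 eqm0; apply: run => a c; rewrite eqm0. Qed.

Lemma runs_skip m B : 0 < B -> runs Skip m B m.
Proof. by move=> B_gt0 m0 eqm; exists 1, m0; split=> //; constructor. Qed.

Lemma runs_store a x y m B m' :
  expr_cost x + expr_cost y < B ->
  update m a (eval w m x) (eval w m y) =2 m' ->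
  runs (Store a x y) m B m'.
Proof.
move=> ltB eqm' m0 eqm; exists (expr_cost x + expr_cost y).+1.
exists (update m0 a (eval w m0 x) (eval w m0 y)); split=> //.
  exact: ExecStore.
by move=> b c; rewrite -eqm' !(eval_ext _ eqm) /update eqm.
Qed.

Lemma runs_seq p q m1 m2 m3 B1 B2 :
  runs p m1 B1 m2 -> runs q m2 B2 m3 -> runs (Seq p q) m1 (B1 + B2) m3.
Proof.
move=> runp runq m0 /runp[T1 [m4 [ex1 le1 /runq[T2 [m5 [ex2 le2 eqm]]]]]].
exists (T1 + T2), m5; split=> //; first exact: ExecSeq ex2.
exact: leq_add.
Qed.

Lemma runs_if x p q m B m' :
  runs (if eval w m x != 0 then p else q) m B m' ->
  runs (If x p q) m (expr_cost x + B).+1 m'.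
Proof.
move=> run m0 eqm; have [T [m1 [ex leT eqm1]]] := run _ eqm.
exists (expr_cost x + T).+1, m1; split=> //; last by rewrite ltnS leq_add2l.
move: ex; rewrite -(eval_ext x eqm); case: ifPn => [nz|/negPn/eqP z] ex.
  exact: ExecIfTrue.
exact: ExecIfFalse.
Qed.

Lemma runs_while_true x p m1 m2 m3 B1 B2 :
  eval w m1 x != 0 -> runs p m1 B1 m2 -> runs (While x p) m2 B2 m3 ->
  runs (While x p) m1 (expr_cost x + B1 + B2).+1 m3.
Proof.
move=> nz runp runq m0 eqm.
have [T1 [m4 [ex1 le1 /runq[T2 [m5 [ex2 le2 eqm5]]]]]] := runp _ eqm.
exists (expr_cost x + T1 + T2).+1, m5; split=> //.
  by apply: ExecWhileTrue ex1 ex2; rewrite (eval_ext x eqm).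
by rewrite ltnS !leq_add.
Qed.

Lemma runs_while_false x p m B :
  eval w m x = 0 -> expr_cost x < B -> runs (While x p) m B m.
Proof.
move=> z ltB m0 eqm; exists (expr_cost x).+1, m0; split=> //.
by apply: ExecWhileFalse; rewrite (eval_ext x eqm).
Qed.

End Runs.

(** * Left neighbours and the forest decomposition *)

Section LeftNeighbours.

Variables (n : nat) (e : rel 'I_n).
Hypotheses (e_simple : simple_graph e) (e_mao : max_adj_ordering e).

Implicit Types u v x y : 'I_n.

Let e_sym : symmetric e. Proof. by case: e_simple. Qed.

Definition ldeg v := size (left_neighbours e v).

(* Indices start at 0: the edge from [v] to [left_nb v i] lies in F_(i + 1). *)
Definition left_nb v i := nth v (left_neighbours e v) i.

Lemma sorted_neighbours v : sorted ltn [seq val u | u <- neighbours e v].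
Proof.
apply: (@subseq_sorted _ _ ltn_trans _ [seq val u | u <- enum 'I_n]).
  exact/map_subseq/filter_subseq.
by rewrite val_enum_ord iota_ltn_sorted.
Qed.

Lemma sorted_left_neighbours v :
  sorted ltn [seq val u | u <- left_neighbours e v].
Proof.
exact: (subseq_sorted ltn_trans (map_subseq _ (filter_subseq _ _)) (sorted_neighbours
  v)).
Qed.

Lemma mem_left_neighbours v u : (u \in left_neighbours e v) = (u < v) && e v u.
Proof. by rewrite 2!mem_filter mem_enum andbT. Qed.

Lemma left_neighbours_uniq v : uniq (left_neighbours e v).
Proof. by rewrite 2?filter_uniq ?enum_uniq. Qed.

Lemma count_below_head (x : 'I_n) (r : seq 'I_n) (c : nat) :
  path ltn x [seq val u | u <- r] -> c <= x ->
  count (fun z : 'I_n => z < c) r = 0.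
Proof.
rewrite (path_sortedE ltn_trans) => /andP[/allP gt_x _] le_cx.
apply/eqP; rewrite -leqn0 leqNgt -has_count; apply/hasPn => z zr.
by rewrite -leqNgt (leq_trans le_cx) // ltnW // gt_x // map_f.
Qed.

(** The input rows list all neighbours in increasing order. Since the left ones form a prefix, the
    program can index a row without filtering it. *)
Lemma neighbours_cat v :
  exists r, neighbours e v = left_neighbours e v ++ r.
Proof.
rewrite /left_neighbours; have := sorted_neighbours v.
elim: (neighbours e v) => [|u r IHr] /=; first by exists [::].
move=> srt; case: ifPn => [_|ge_uv].
  by have [r' def_r] := IHr (path_sorted srt); exists r'; rewrite {1}def_r.
exists (u :: r); rewrite (_ : [seq _ <- r | _] = [::]) //.
by apply: size0nil; rewrite size_filter (count_below_head srt) // leqNgt.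
Qed.

Lemma nth_neighbours v i :
  i < ldeg v -> nth v (neighbours e v) i = left_nb v i /\ i < size (neighbours e v).
Proof.
have [r ->] := neighbours_cat v => lt_i; rewrite nth_cat size_cat -/(ldeg v) lt_i.
by split=> //; rewrite ltn_addr.
Qed.

Lemma left_nb_mem v i : i < ldeg v -> left_nb v i \in left_neighbours e v.
Proof. exact: mem_nth. Qed.

Lemma left_nb_lt v i : i < ldeg v -> left_nb v i < v.
Proof. by move/left_nb_mem; rewrite mem_left_neighbours => /andP[]. Qed.

Lemma left_nb_edge v i : i < ldeg v -> e v (left_nb v i).
Proof. by move/left_nb_mem; rewrite mem_left_neighbours => /andP[]. Qed.

Lemma left_nb_inj v i j :
  i < ldeg v -> j < ldeg v -> left_nb v i = left_nb v j -> i = j.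
Proof.
move=> lti ltj /eqP; rewrite /left_nb nth_uniq ?left_neighbours_uniq //.
by move/eqP.
Qed.

Lemma left_nb_ltn v i j :
  i < ldeg v -> j < ldeg v -> (left_nb v i < left_nb v j) = (i < j).
Proof.
have mono a b : a < b -> b < ldeg v -> left_nb v a < left_nb v b.
  move=> ltab ltb; have lta := ltn_trans ltab ltb.
  have := sorted_ltn_nth ltn_trans 0 (sorted_left_neighbours v).
  move=> /(_ a b); rewrite !inE size_map => /(_ lta ltb ltab).
  by rewrite !(nth_map v).
move=> lti ltj; case: (ltngtP i j) => [ltij|ltji|->]; last by rewrite ltnn.
  by rewrite mono.
by apply/negbTE; rewrite -leqNgt ltnW // mono.
Qed.

Lemma nb_beforeE u v :
  u <= v -> nb_before e u v = count (fun x : 'I_n => x < u) (left_neighbours e v).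
Proof.
move=> le_uv; rewrite -size_filter /nb_before cardE -!filter_predI.
congr size; rewrite /enum_mem -enumT; apply: eq_filter => x /=.
rewrite !inE e_sym; case: ltnP => //= lt_xu.
by rewrite (leq_trans lt_xu le_uv) andbC.
Qed.

Lemma nb_before_self v : nb_before e v v = ldeg v.
Proof.
rewrite nb_beforeE // -size_filter; congr size; apply/all_filterP/allP => x.
by rewrite mem_left_neighbours => /andP[].
Qed.

(** In a sorted list the entries below [u] form a prefix, so comparing vertices with [u] amounts to
    comparing indices with a count. *)
Lemma left_nb_before u v i :
  u <= v -> i < ldeg v -> (left_nb v i < u) = (i < nb_before e u v).
Proof.
move=> le_uv lti; rewrite nb_beforeE //; move: lti; rewrite /left_nb /ldeg.
have := sorted_left_neighbours v.
elim: (left_neighbours e v) i => [|x r IHr] [|i] //= srt lti.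
  by case: ltnP => // le_ux; rewrite (count_below_head srt).
rewrite IHr ?(path_sorted srt) //; case: (ltnP x u) => // le_ux.
by rewrite (count_below_head srt).
Qed.

(** The form in which maximality of the ordering enters all later arguments. *)
Lemma nb_before_leq u v : u <= v -> nb_before e u v <= ldeg u.
Proof.
rewrite leq_eqVlt => /orP[/eqP/val_inj <-|/e_mao]; first by rewrite nb_before_self.
by rewrite nb_before_self.
Qed.

Lemma nb_before_leq_ldeg u v : u <= v -> nb_before e u v <= ldeg v.
Proof. by move=> le_uv; rewrite nb_beforeE // count_size. Qed.

Lemma is_left_neighbourP i u v :
  reflect (exists2 j, i = j.+1 & j < ldeg v /\ u = left_nb v j)
          (is_left_neighbour e i v u).
Proof.
apply: (iffP andP) => [[uL /eqP <-]|[j -> [ltj ->]]].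
  exists (index u (left_neighbours e v)) => //.
  by rewrite /ldeg index_mem uL /left_nb nth_index.
by rewrite left_nb_mem // /left_nb index_uniq ?left_neighbours_uniq.
Qed.

Lemma forest_sym i : connect_sym (forest e i).
Proof. by apply: sym_connect_sym => u v; apply: orbC. Qed.

Lemma forest_left_nb v i : i < ldeg v -> connect (forest e i.+1) v (left_nb v i).
Proof.
move=> lti; apply: connect1; apply/orP; right; apply/is_left_neighbourP.
by exists i.
Qed.

(* Let [a] and [b] be the left neighbours of index [i] of [u] and [v]. If [a < b],
   then [b] and [u] have more than [i] neighbours before [b], so that induction
   applies to them; the case [b < a] is symmetric. *)
Lemma forest_connect u v i :
  u < v -> i < nb_before e u v -> connect (forest e i.+1) u v.
Proof.
have [N] := ubnP (val u); elim: N u v => // N IHN u v.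
rewrite ltnS => leN lt_uv lti.
have ltiu := leq_trans lti (nb_before_leq (ltnW lt_uv)).
have ltiv := leq_trans lti (nb_before_leq_ldeg (ltnW lt_uv)).
have a_lt := left_nb_lt ltiu.
have b_lt : left_nb v i < u by rewrite left_nb_before // ltnW.
have cua := forest_left_nb ltiu; have cvb := forest_left_nb ltiv.
case: (ltngtP (left_nb u i) (left_nb v i)) => [lt_ab|lt_ba|/val_inj eq_ab].
- rewrite forest_sym (connect_trans cvb) //; apply: IHN => //;
  first exact: leq_trans leN.
  by rewrite -left_nb_before // ltnW.
- rewrite (connect_trans cua) //; apply: IHN; [exact: leq_trans leN|lia|].
  by rewrite -left_nb_before //; lia.
- by rewrite (connect_trans cua) // eq_ab forest_sym.
Qed.

(** Let [u] be the left neighbour of [v] of index [j]. The neighbour of index [i < j] lies before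
    [u], so [v] has more than [i] neighbours before [u] and [forest_connect] joins the two ends of
    the edge. *)
Lemma forest_nested i j u v :
  i <= j -> connect (forest e j.+1) u v -> connect (forest e i.+1) u v.
Proof.
rewrite leq_eqVlt => /orP[/eqP -> //|lt_ij]; apply: connect_sub => {u v}.
suff nested u v : is_left_neighbour e j.+1 v u -> connect (forest e i.+1) u v.
  by move=> u v /orP[/nested //|/nested]; rewrite forest_sym.
move=> /is_left_neighbourP[_ [<-] [ltj ->]].
apply: forest_connect; first exact: left_nb_lt.
have lti := ltn_trans lt_ij ltj.
by rewrite -left_nb_before ?left_nb_ltn // ltnW // left_nb_lt.
Qed.

(** Suppose [ldeg u <= i]. A forest edge from some [x >= u] to a vertex before [u] leads to the left
    neighbour of [x] of index [i], so [x] has more than [i] neighbours before [u], against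
    maximality. Thus no path from [u] gets to the left of [u]. *)
Lemma forest_root u v i :
  connect (forest e i.+1) u v -> v < u -> i < ldeg u.
Proof.
move=> /connectP[p]; rewrite ltnNge => pth ->; apply: contraNltn => le_ui.
suff: all (fun x : 'I_n => u <= x) (u :: p).
  by move/allP; apply; rewrite mem_last.
have: u <= u by [].
elim: p {1 3 5}u pth => [|y p IHp] x /=; first by rewrite andbT.
move=> /andP[xy pth] le_ux; rewrite le_ux; apply: IHp => //.
rewrite leqNgt; apply/negP => lt_yu; case/orP: xy.
  by move=> /is_left_neighbourP[_ [<-] [/left_nb_lt + eq_x]]; rewrite -eq_x; lia.
move=> /is_left_neighbourP[_ [<-] [ltj eq_y]].
move: lt_yu; rewrite eq_y left_nb_before //.
by have := nb_before_leq le_ux; lia.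
Qed.

End LeftNeighbours.

(** * Ends of paths: counting and membership in the trees *)

Section Ends.

Variables (n : nat) (e : rel 'I_n).
Hypotheses (e_simple : simple_graph e) (e_mao : max_adj_ordering e).
Variable s : 'I_n.

Implicit Types (u v x y : 'I_n) (X Y : {set 'I_n}).

Definition below X (c : nat) : nat := #|[set x in X | x < c]|.

Lemma below_leq X c d : c <= d -> below X c <= below X d.
Proof.
move=> le_cd; apply/subset_leq_card/subsetP => x.
by rewrite !inE => /andP[-> /leq_trans->].
Qed.

Lemma belowS X x : below X x.+1 = (x \in X) + below X x.
Proof.
rewrite /below; case: (boolP (x \in X)) => xX.
  rewrite (cardsD1 x) !inE xX ltnSn; congr (_ + #|pred_of_set _|).
  by apply/setP=> z; rewrite !inE ltnS -val_eqE /=; case: (z \in X) => //=; lia.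
congr #|pred_of_set _|; apply/setP=> z; rewrite !inE ltnS leq_eqVlt val_eqE.
by case: eqP => [->|//]; rewrite (negbTE xX).
Qed.

Lemma below_setU1 X y c : y \notin X -> below (y |: X) c = (y < c) + below X c.
Proof.
move=> yX; rewrite /below; case: (boolP (y < c)) => lt_yc.
  rewrite (cardsD1 y) !inE eqxx lt_yc; congr (_ + #|pred_of_set _|).
  by apply/setP=> z; rewrite !inE; case: eqP => [->|//]; rewrite (negbTE yX).
congr #|pred_of_set _|; apply/setP=> z; rewrite !inE.
by case: eqP => [->|//]; rewrite (negbTE lt_yc) !andbF.
Qed.

Lemma below_gt0 X x c : x \in X -> x < c -> 0 < below X c.
Proof. by move=> xX ltx; rewrite card_gt0; apply/set0Pn; exists x; rewrite inE xX. Qed.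

Lemma eq_below X Y c :
  (forall x, x < c -> (x \in X) = (x \in Y)) -> below X c = below Y c.
Proof.
move=> eqXY; congr #|pred_of_set _|; apply/setP=> x; rewrite !inE.
by case: ltnP => [/eqXY->|]; rewrite ?andbF.
Qed.

(* [T_0] is taken to be the whole graph. *)
Definition in_tree (i : nat) (u : 'I_n) : bool :=
  (i == 0) || connect (forest e i) s u.

Lemma in_tree_nested i j u : i <= j -> in_tree j u -> in_tree i u.
Proof.
case: i j => [|i] [|j] //; rewrite ltnS /in_tree /= => le_ij.
exact: forest_nested.
Qed.

Lemma in_tree_trans i u v :
  in_tree i.+1 u -> connect (forest e i.+1) u v -> in_tree i.+1 v.
Proof. exact: connect_trans. Qed.

(* The condition on the ends [X] below [c] that every step of the sweep preserves:
   the bound on [ldeg] lets them advance, and the trees account for the time. *)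
Definition good X (c : nat) : Prop :=
  (forall u, u <= c -> below X u <= ldeg e u /\ in_tree (below X u) u) /\
  (forall a, a \in X -> a < c -> in_tree (below X a).+1 a).

Lemma good_leq X c d : c <= d -> good X d -> good X c.
Proof.
move=> le_cd [goodl goodX]; split=> [u le_uc|a aX lt_ac].
  exact/goodl/(leq_trans le_uc).
exact/goodX/(leq_trans lt_ac).
Qed.

Lemma good_eq X Y c :
  (forall x, x < c -> (x \in X) = (x \in Y)) -> good X c -> good Y c.
Proof.
move=> eqXY [goodl goodX].
have eqb u : u <= c -> below Y u = below X u.
  by move=> le_uc; apply: eq_below => x ltx; rewrite eqXY //; apply: leq_trans le_uc.
split=> [u le_uc|a aX lt_ac]; first by rewrite eqb //; apply: goodl.
by rewrite eqb 1?ltnW //; apply: goodX => //; rewrite eqXY.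
Qed.

Lemma in_tree_before u x i j :
  u < x -> i < j -> i < nb_before e u x -> in_tree j x -> in_tree i.+1 u.
Proof.
move=> lt_ux lt_ij lti /(in_tree_nested lt_ij)/in_tree_trans; apply.
by rewrite forest_sym forest_connect.
Qed.

Lemma in_tree_left_nb x i j :
  i < ldeg e x -> i < j -> in_tree j x -> in_tree i.+1 (left_nb e x i).
Proof.
move=> lti lt_ij /(in_tree_nested lt_ij)/in_tree_trans; apply.
exact: forest_left_nb.
Qed.

Definition left_nbs x j : {set 'I_n} := [set y in take j (left_neighbours e x)].

Lemma left_nbsP x j y : j <= ldeg e x ->
  reflect (exists2 i, i < j & y = left_nb e x i) (y \in left_nbs x j).
Proof.
move=> lej; rewrite inE; have szt : size (take j (left_neighbours e x)) = j.
  exact: size_takel.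
apply: (iffP (nthP x)); rewrite szt => -[i lti def_y]; exists i => //.
  by rewrite -def_y nth_take.
by rewrite nth_take.
Qed.

Lemma left_nbs_lt x j y : y \in left_nbs x j -> y < x.
Proof.
by rewrite inE => /mem_take; rewrite mem_left_neighbours => /andP[].
Qed.

(** The left neighbours of index [p], ..., [q - 1] are distinct elements of [X] between [c] and [x],
    disjoint from those counted by [below X c]. With [p = c = 0] this is the pigeonhole principle
    behind [advance_exists]. *)
Lemma card_indices X x c p q :
  (forall i, p <= i -> i < q -> left_nb e x i \in X /\ c <= left_nb e x i) ->
  q <= ldeg e x -> c <= x -> q + below X c <= p + below X x.
Proof.
move=> inX leq_q le_cx; case: (leqP p q) => [le_pq|lt_qp]; last first.
  by rewrite leq_add ?below_leq // ltnW.
have: uniq [seq left_nb e x i | i <- iota p (q - p)].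
  rewrite map_inj_in_uniq ?iota_uniq // => i i'.
  by rewrite !mem_iota => ? ?; apply: left_nb_inj; lia.
move=> /card_uniqP; rewrite size_map size_iota => card_s.
set A := [set y in X | y < c].
set B := [set y in [seq left_nb e x i | i <- iota p (q - p)]].
have disj: [disjoint A & B].
  apply/pred0P => y /=; rewrite !inE; apply/negbTE/negP.
  move=> /andP[/andP[_ lty] /mapP[i]]; rewrite mem_iota => ri def_y.
  by case: (inX i) => [||_]; [lia|lia|rewrite -def_y leqNgt lty].
have: below X c + (q - p) <= below X x.
  have [_] := leq_card_setU A B; rewrite disj => /eqP.
  rewrite [#|B|]cardsE card_s => <-.
  apply/subset_leq_card/subsetP => y; rewrite !inE => /orP[/andP[-> lty]|].
    exact: leq_trans le_cx.
  move=> /mapP[i]; rewrite mem_iota => ri def_y.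
  case: (inX i) => [||]; [lia|lia|rewrite -def_y => -> _].
  by rewrite def_y left_nb_lt //; lia.
lia.
Qed.

Lemma left_nbs_count x j u : j <= ldeg e x -> u <= x ->
  below (left_nbs x j) u = minn j (nb_before e u x).
Proof.
move=> lej le_ux; rewrite -[RHS](size_iota 0) -(size_map (left_nb e x)).
have lt_before i : i < minn j (nb_before e u x) -> i < j /\ i < nb_before e u x.
  by rewrite leq_min => /andP[].
rewrite -(card_uniqP _) ?map_inj_in_uniq ?iota_uniq // => [|i i']; last first.
  rewrite !mem_iota => /lt_before[? _] /lt_before[? _].
  by apply: left_nb_inj; lia.
apply: eq_card => y; rewrite in_set; apply/andP/mapP => [[]|[i]].
  move=> /(left_nbsP _ lej)[i lti ->]; have ltid := leq_trans lti lej.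
  rewrite left_nb_before // => lti'.
  by exists i => //; rewrite mem_iota leq_min lti.
rewrite mem_iota => /lt_before[lti lti'] ->; have ltid := leq_trans lti lej.
rewrite left_nb_before //; split=> //.
by apply/(left_nbsP _ lej); exists i.
Qed.

(** This starts the paths from [s], and those from [t] once the sweep arrives there. The number of
    ends before [u] is at most [nb_before e u x], which maximality bounds by [ldeg e u]. *)
Lemma good_left_nbs x j :
  j <= ldeg e x -> in_tree j x -> good (left_nbs x j) x.
Proof.
move=> lej xT; split=> [u le_ux|_ /(left_nbsP _ lej)[i lti ->] lt_ax].
  rewrite left_nbs_count // geq_min nb_before_leq // orbT; split=> //.
  move: le_ux; rewrite leq_eqVlt => /predU1P[/val_inj->|lt_ux].
    by apply: in_tree_nested xT; rewrite geq_minl.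
  case def_m: (minn _ _) => [//|m].
  have: m < minn j (nb_before e u x) by rewrite def_m.
  by rewrite leq_min => /andP[ltmj ltm]; apply: in_tree_before xT.
have ltid := leq_trans lti lej.
apply: in_tree_nested (in_tree_left_nb ltid lti xT).
rewrite ltnS left_nbs_count ?(ltnW lt_ax) // geq_min.
by rewrite [X in _ || X]leqNgt -left_nb_before ?ltnn ?orbT // ltnW.
Qed.

(* The end [x] of rank [j] advances to the largest of its first [j] left
   neighbours that is not an end. *)
Lemma good_advance X x i :
  x \in X -> good X x.+1 -> below X x < ldeg e x ->
  i <= below X x -> left_nb e x i \notin X ->
  (forall i', i < i' -> i' <= below X x -> left_nb e x i' \in X) ->
  good (left_nb e x i |: X) x.
Proof.
move=> xX [goodl goodX] ltd; set y := left_nb e x i => lei yX maxi.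
set b := below X x in ltd lei maxi.
have ltid := leq_ltn_trans lei ltd.
have lt_yx : y < x by apply: left_nb_lt.
have xT : in_tree b.+1 x by apply: goodX.
(* By the choice of [i], the neighbours of index [p], ..., [b] are ends; if they all lie at or after
   [c], they are among the [b] ends before [x] but not among those before [c]. *)
have count p c : i < p -> c <= x ->
    (forall i', p <= i' -> i' <= b -> c <= left_nb e x i') ->
    b.+1 + below X c <= p + b.
  move=> ltip le_cx lec; apply: card_indices => // i' lepi' lti'.
  by split; [apply: maxi => //; apply: leq_trans lepi'|apply: lec].
have beforeP u i' : u <= x -> nb_before e u x <= i' -> i' <= b ->
    u <= left_nb e x i'.
  move=> le_ux leu lei'; have ltid' := leq_ltn_trans lei' ltd.
  by rewrite leqNgt left_nb_before // -leqNgt.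
split=> [u le_ux|a]; rewrite below_setU1 //.
  move: le_ux; rewrite leq_eqVlt => /predU1P[/val_inj->|lt_ux].
    by rewrite lt_yx.
  case: (ltnP y u) => [lt_yu|_]; last by apply: goodl; rewrite ltnW // ltnS ltnW.
  rewrite add1n; have le_ub : below X u <= b by rewrite below_leq // ltnW.
  have ltu : below X u < nb_before e u x.
    (* If [x] has at most [b] neighbours before [u], those of the remaining indices up to [b] are
       ends at or after [u], which leaves fewer than [nb_before e u x] ends before [u]. *)
    case: (leqP b.+1 (nb_before e u x)) => [|gtb]; first by lia.
    have : i < nb_before e u x by rewrite -left_nb_before // ltnW.
    move=> /count/(_ (ltnW lt_ux)) H.
    by have := H (fun i' => @beforeP _ i' (ltnW lt_ux)); lia.
  split; first exact: leq_trans ltu (nb_before_leq e_simple e_mao (ltnW lt_ux)).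
  exact: in_tree_before xT.
(* For the new end [y]: the neighbours of index [i + 1], ..., [b] are ends to the right of [y], so
   at most [i] ends precede it. *)
case/setU1P=> [->|aX] lt_ax; first rewrite ltnn.
  apply: in_tree_nested (in_tree_left_nb ltid (leq_ltn_trans lei (ltnSn _)) xT).
  have := count i.+1 y.+1 (ltnSn _) lt_yx; rewrite belowS (negbTE yX).
  suff H: forall i', i < i' -> i' <= b -> y < left_nb e x i' by move/(_ H); lia.
  by move=> i' ltii' lei'; rewrite left_nb_ltn //; lia.
case: (ltnP y a) => [lt_ya|_]; last by apply: goodX => //; rewrite ltnW.
(* An old end [a] to the right of [y] gains one in rank. If it is the neighbour of index [i'], the
   ends of larger index keep its new rank at most [i']; otherwise the count is the one made for [u]
   above. *)
rewrite add1n; have [/(left_nbsP _ ltd)[i' lti' def_a]|aN] := boolP (a \in left_nbs x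
  b.+1).
  have ltd' := leq_trans lti' ltd.
  rewrite {2}def_a; apply: in_tree_nested (in_tree_left_nb ltd' lti' xT).
  have ltii' : i < i' by move: lt_ya; rewrite def_a left_nb_ltn.
  have := count i'.+1 a.+1 (ltnW ltii') lt_ax; rewrite belowS aX.
  suff H: forall k, i' < k -> k <= b -> a < left_nb e x k by move/(_ H); lia.
  by move=> k ltk lek; rewrite def_a left_nb_ltn //; lia.
have le_ab : below X a < b.
  by have := below_leq X lt_ax; rewrite belowS aX.
apply: (in_tree_before lt_ax _ _ xT); first by lia.
case: (leqP b.+1 (nb_before e a x)) => [|gtb]; first by lia.
have : i < nb_before e a x by rewrite -left_nb_before // ltnW.
move=> /count/(_ lt_ax); rewrite belowS aX.
suff H: forall k, nb_before e a x <= k -> k <= b -> a < left_nb e x k.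
  by move/(_ H); lia.
move=> k lek lekb; rewrite ltn_neqAle (beforeP _ _ (ltnW lt_ax)) // andbT.
apply: contra aN => /eqP/val_inj def_a; apply/(left_nbsP _ ltd).
by exists k.
Qed.

(** The first [below X x + 1] left neighbours of [x] cannot all be among the [below X x] ends before
    [x]. *)
Lemma advance_exists X x :
  x \in X -> below X x < ldeg e x ->
  exists i, [/\ i <= below X x, left_nb e x i \notin X &
    forall i', i < i' -> i' <= below X x -> left_nb e x i' \in X].
Proof.
move=> xX ltd.
have exi: exists i, (i <= below X x) && (left_nb e x i \notin X).
  have [/existsP[i nX]|allX] :=
    boolP [exists i : 'I_(below X x).+1, left_nb e x i \notin X].
    by exists i; rewrite -ltnS ltn_ord.
  have := @card_indices X x 0 0 (below X x).+1.
  suff H: forall i, 0 <= i -> i < (below X x).+1 -> left_nb e x i \in X /\ 0 <=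
    left_nb e x i.
    by move/(_ H ltd isT); lia.
  move=> i _ lti; split=> //; apply: contraNT allX => nX.
  by apply/existsP; exists (Ordinal lti).
have [i /andP[lei nX] maxi] := ex_maxnP exi (fun i Hi => proj1 (andP Hi)).
exists i; split=> // i' ltii' lei'; apply: contraLR ltii' => nX'.
by rewrite -leqNgt maxi // lei'.
Qed.

End Ends.

(** * The sweep *)

Section Sweep.

Variables (n : nat) (e : rel 'I_n).
Hypotheses (e_simple : simple_graph e) (e_mao : max_adj_ordering e).
Variables (s t : 'I_n) (k : nat).
Hypotheses (le_k : k <= ldeg e s) (lt_ts : t < s) (tT : in_tree e s k t).
Hypothesis k_gt0 : 0 < k.

Implicit Types (u v x y : 'I_n) (A : {set 'I_n}) (g : 'I_n -> 'I_n).

(** The share of [u] in the time bound: each edge of the union is charged to its right end. *)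
Definition tree_ldeg u : nat :=
  #|[set y : 'I_n | (y < u) && ([set u; y] \in union_tree_edges e k s)]|.

Lemma tree_ldeg_geq u i :
  i <= k -> in_tree e s i u -> i <= ldeg e u -> i <= tree_ldeg u.
Proof.
move=> lei uT led.
apply: (@leq_trans (below (left_nbs e u i) u)).
  by rewrite left_nbs_count // nb_before_self // leq_min leqnn.
apply/subset_leq_card/subsetP => y; rewrite !inE => /andP[yL ->] /=.
have /(left_nbsP _ led)[i' lti' def_y] : y \in left_nbs e u i by rewrite inE.
have ltd := leq_trans lti' led.
apply/bigcupP; exists (Ordinal (leq_trans lti' lei)) => //.
rewrite inE; apply/andP; split.
  apply/imsetP; exists (u, y) => //; rewrite inE.
  apply/orP; right; apply/is_left_neighbourP.
  by exists i'.
apply/subsetP => z; rewrite !inE => /orP[] /eqP->.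
  exact: in_tree_nested lti' uT.
by rewrite def_y; apply: in_tree_left_nb lti' uT.
Qed.

Lemma sum_tree_ldeg : \sum_u tree_ldeg u <= #|union_tree_edges e k s|.
Proof.
pose P := [set p : 'I_n * 'I_n |
  (p.2 < p.1) && ([set p.1; p.2] \in union_tree_edges e k s)].
have -> : \sum_u tree_ldeg u = #|P|.
  rewrite -sum1_card (eq_bigr (fun u => \sum_y (if (u, y) \in P then 1 else 0))).
    by rewrite pair_big [RHS]big_mkcond; apply: eq_bigr => -[].
  by move=> u _; rewrite /tree_ldeg -sum1_card [LHS]big_mkcond;
    apply: eq_bigr => y _; rewrite !inE.
rewrite -(card_in_imset (f := fun p => [set p.1; p.2])) => [|p q].
  by apply/subset_leq_card/subsetP => _ /imsetP[p + ->]; rewrite inE => /andP[].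
case: p q => [p1 p2] [q1 q2]; rewrite !inE /= => /andP[ltp _] /andP[ltq _] eqpq.
have: p1 \in [set q1; q2] by rewrite -eqpq set21.
have: p2 \in [set q1; q2] by rewrite -eqpq set22.
rewrite !inE -!val_eqE /= => E2 E1.
by congr (_, _); apply/val_inj; rewrite /=; clear -ltp ltq E1 E2; lia.
Qed.

(* [u \in others g] is encoded by [g u != 0]: an end [u] of a path from [t] was
   reached from [g u > u]. *)
Definition others g : {set 'I_n} := [set u | g u != 0 :> nat].

(* The vertices from which [g] already leads one step further towards [t], when
   the sweep has come down to [v]. *)
Definition linked (c : nat) A g : {set 'I_n} :=
  [set u | (u != t) && ((c <= u) && (u \in A) || (u \in others g))].

Lemma mem_linked c A g u : u \in linked c A g =
  (u != t) && ((c <= u) && (u \in A) || (u \in others g)).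
Proof. by rewrite in_set. Qed.

(* The ends below [c] of the paths from [s] are the elements of [A] below [c],
   those of the paths from [t] the elements of [others g] below [c]. *)
Record sweep_inv (c j : nat) A g : Prop := SweepInv {
  inv_le : c <= s;
  inv_leq : j <= k;
  inv_below : below A c = j;
  inv_good : good e s A c;
  inv_others : c <= t -> below (others g) c = j /\ good e s (others g) c;
  inv_early : t < c -> j = k /\ (forall u, u \in others g -> c <= u);
  inv_lt : forall u, u \in A -> u < s;
  inv_others_lt : forall u, u \in others g -> u < s /\ u != t;
  inv_edge : forall u, u \in linked c A g -> e u (g u);
  inv_next : forall u, u \in linked c A g -> g u \in t |: (A :|: others g);
  inv_pending : forall u, u \in linked c A g -> g u < c -> g u \in A;
  inv_inj : forall u u', u \in linked c A g -> u' \in linked c A g ->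
    g u = g u' -> g u != t -> u = u';
  inv_start : forall i, i < k -> left_nb e s i \in A;
  inv_start_hit : forall u i, u \in linked c A g -> i < k ->
    g u = left_nb e s i -> g u = t;
  inv_tree : forall u, c < u -> u < s -> 0 < tree_ldeg u
}.

Lemma sT i : in_tree e s i s.
Proof. by rewrite /in_tree connect0 orbT. Qed.

Lemma sweep_inv0 (z : 'I_n) :
  z = 0 :> nat -> sweep_inv s k (left_nbs e s k) (fun _ => z).
Proof.
move=> z0; have noB u : u \in others (fun _ => z) = false by rewrite inE z0.
have noD u : u \in linked s (left_nbs e s k) (fun _ => z) = false.
  rewrite !inE z0 eqxx orbF; apply/negbTE; rewrite negb_and; apply/orP; right.
  apply/negP => /andP[le_su uL].
  have: u < s by apply: (@left_nbs_lt _ e s k); rewrite inE.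
  by rewrite ltnNge le_su.
split=> //; try by [move=> u; rewrite noD | move=> u u'; rewrite noD].
- by rewrite left_nbs_count // nb_before_self //; apply/minn_idPl.
- exact/good_left_nbs/sT.
- by rewrite leqNgt lt_ts.
- by split=> // u; rewrite noB.
- by move=> u; apply: left_nbs_lt.
- by move=> u; rewrite noB.
- by move=> i ltik; apply/left_nbsP => //; exists i.
- by move=> u lt_su; rewrite ltnNge ltnW.
Qed.

Section Step.

Variables (x : 'I_n) (j : nat) (A : {set 'I_n}) (g : 'I_n -> 'I_n).
Hypothesis inv : sweep_inv x.+1 j A g.
Hypothesis j_gt0 : 0 < j.

Lemma inv_tree_step u : x < u -> u < s -> 0 < tree_ldeg u.
Proof.
rewrite leq_eqVlt => /predU1P[def_u lt_us|]; last exact: (inv_tree inv).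
have := (inv_good inv).1 u; rewrite -def_u leqnn (inv_below inv) => /(_ isT)[ltd uT].
exact: leq_trans (tree_ldeg_geq (inv_leq inv) uT ltd).
Qed.

Lemma lt_xs : x < s. Proof. exact: inv_le inv. Qed.

Lemma inv_goodx : good e s A x. Proof. exact: good_leq (inv_good inv). Qed.

Lemma inv_split : below A x + (x \in A) = j.
Proof. by rewrite -(inv_below inv) belowS addnC. Qed.

(** Passing [x] makes it linked only if [x] is an end of a path from [s], differs from [t] and
    carries no link yet. *)
Lemma linked_same :
  (x == t) || (x \notin A) || (x \in others g) ->
  linked x A g = linked x.+1 A g.
Proof.
move=> Hx; apply/setP=> u; rewrite !in_set leq_eqVlt.
case: (x =P u :> nat) => [/val_inj <-|//]; move: Hx; rewrite ltnn /= in_set.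
by case: eqP => //= _; case: (x \in A); rewrite ?orbF //= => ->.
Qed.

Lemma step_skip : x != t -> x \notin A -> x \notin others g -> sweep_inv x j A g.
Proof.
move=> xt xA xB; have eqD : linked x A g = linked x.+1 A g.
  by apply: linked_same; rewrite xA orbT.
split; rewrite ?eqD; try by [case: inv].
- exact: ltnW lt_xs.
- by rewrite -inv_split (negbTE xA) addn0.
- exact: inv_goodx.
- rewrite leq_eqVlt val_eqE (negbTE xt) => lt_xt; have [eqj gd] := inv_others inv lt_xt.
  by split; [rewrite -eqj belowS (negbTE xB)|apply: good_leq gd].
- move=> lt_tx; have [-> leB] := inv_early inv (leqW lt_tx); split=> // u uB.
  exact: ltnW (leB _ uB).
- by move=> u uD lt_gu; apply: (inv_pending inv uD); apply: leqW.
- exact: inv_tree_step.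
Qed.

(** The link at [x], left by the path from [t], already continues the path from [s]; only the number
    of open paths changes. *)
Lemma step_meet : x != t -> x \in A -> x \in others g -> sweep_inv x j.-1 A g.
Proof.
move=> xt xA xB; have eqD : linked x A g = linked x.+1 A g.
  by apply: linked_same; rewrite xB orbT.
have lt_xt : x < t.
  rewrite ltn_neqAle val_eqE xt leqNgt; apply/negP=> lt_tx.
  by have [_ /(_ _ xB)] := inv_early inv (leqW lt_tx); rewrite ltnn.
split; rewrite ?eqD; try by [case: inv].
- exact: ltnW lt_xs.
- by have := inv_leq inv; lia.
- by rewrite -inv_split xA addn1.
- exact: inv_goodx.
- have [eqj gd] := inv_others inv lt_xt => _.
  by split; [rewrite -eqj belowS xB|apply: good_leq gd].
- by move=> lt_tx; have := ltn_trans lt_tx lt_xt; rewrite ltnn.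
- by move=> u uD lt_gu; apply: (inv_pending inv uD); apply: leqW.
- exact: inv_tree_step.
Qed.

(** Left of [t], all [j] ends of the other kind lie before [x], and [good] for them gives [j] left
    neighbours. Right of [t] there are no such ends; there [j = k], so [x] lies in [T_k] together
    with [t < x], and [forest_root] applies. *)
Lemma ldeg_A : x != t -> x \in A -> x \notin others g -> below A x < ldeg e x.
Proof.
move=> xt xA xB; have := inv_split; rewrite xA addn1 => eqj.
case: (ltngtP x t) => [lt_xt|lt_tx|/val_inj/eqP]; last by rewrite (negbTE xt).
  have [eqB [gd _]] := inv_others inv lt_xt.
  by have := gd x (leqW (leqnn x)); move: eqB;
    rewrite belowS (negbTE xB) add0n -eqj => -> [].
have [eqjk _] := inv_early inv (leqW lt_tx).
have := (inv_good inv).2 x xA (ltnSn x); rewrite eqj eqjk => xT.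
move: tT xT k_gt0; rewrite -eqjk -eqj /in_tree /= => sTt sTx _.
apply: (forest_root e_simple e_mao _ lt_tx).
by apply: connect_trans sTt; rewrite forest_sym.
Qed.

(** As [x] is not in [A], all [j] open ends in [A] lie before [x], and [good] for [A] gives [j] left
    neighbours, one more than there are ends of the other kind before [x]. *)
Lemma ldeg_others : x \in others g -> x < t -> x \notin A ->
  below (others g) x < ldeg e x.
Proof.
move=> xB lt_xt xA; have := inv_split; rewrite (negbTE xA) addn0 => eqj.
have [eqB _] := inv_others inv lt_xt; move: eqB; rewrite belowS xB add1n -eqj => ->.
by case: (inv_goodx.1 x (leqnn x)).
Qed.

Lemma step_A i :
  let y := left_nb e x i in
  x != t -> x \in A -> x \notin others g ->
  i < j -> y \notin A -> (forall i', i < i' -> i' < j -> left_nb e x i' \in A) ->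
  sweep_inv x j (y |: A) [eta g with x |-> y].
Proof.
move=> y xt xA xB ltij yA maxi; set g' := [eta _ with _ |-> _].
have ltd := ldeg_A xt xA xB; have eqj := inv_split; rewrite xA addn1 in eqj.
have lti : i < ldeg e x by rewrite (leq_trans ltij) // -eqj.
have lt_yx : y < x by apply: left_nb_lt.
have g'E u : u != x -> g' u = g u by move=> ux; rewrite /= (negbTE ux).
have g'x : g' x = y by rewrite /= eqxx.
have subB u : u \in others g -> u \in others g'.
  move=> uB; have ux: u != x by apply: contraNneq xB => <-.
  by rewrite in_set g'E //; move: uB; rewrite in_set.
have othersE u : u != x -> u \in others g' = (u \in others g).
  by move=> ux; rewrite !in_set g'E.
have linkedP u : u \in linked x (y |: A) g' -> u = x \/ u != x /\ u \in linked x.+1 A g.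
  move=> H; case: (eqVneq u x) => [->|ux]; [by left|right; split=> //]; move: H.
  rewrite !mem_linked => /andP[-> /orP[/andP[le_xu]|]];
    last by rewrite othersE // => ->; rewrite orbT.
  case/setU1P=> [eq_u|->]; first by move: le_xu; rewrite eq_u leqNgt lt_yx.
  by rewrite ltn_neqAle le_xu val_eqE eq_sym ux.
have next u : u \in t |: (A :|: others g) -> u \in t |: ((y |: A) :|: others g').
  rewrite !in_setU !in_set1; case/or3P=> [-> //|->|/subB->]; by rewrite !orbT.
split.
- exact: ltnW lt_xs.
- exact: (inv_leq inv).
- by rewrite below_setU1 // lt_yx add1n.
- by apply: good_advance => //; [exact: (inv_good inv)|lia|move=> i' lti' ?;
  apply: maxi => //; lia].
- rewrite leq_eqVlt val_eqE (negbTE xt) => lt_xt; have [eqB gd] := inv_others inv lt_xt.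
  have eqO (z : 'I_n) : z < x -> (z \in others g) = (z \in others g').
    by move=> ltz; rewrite othersE // -val_eqE ltn_eqF.
  split; last exact: good_eq eqO (good_leq (leqnSn _) gd).
  by rewrite -(eq_below eqO) -eqB belowS (negbTE xB).
- move=> lt_tx; have [-> leB] := inv_early inv (leqW lt_tx); split=> // u.
  by case: (eqVneq u x) => [-> //|ux]; rewrite othersE // => /leB /ltnW.
- by move=> u /setU1P[->|/(inv_lt inv) //]; apply: ltn_trans lt_xs.
- move=> u; case: (eqVneq u x) => [-> _|ux]; first by rewrite lt_xs.
  by rewrite othersE //; apply: (inv_others_lt inv).
- move=> u /linkedP[->|[ux uD]]; first by rewrite g'x left_nb_edge.
  by rewrite g'E //; apply: (inv_edge inv uD).
- move=> u /linkedP[->|[ux uD]]; first by rewrite g'x !in_setU !in_set1 eqxx orbT.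
  by rewrite g'E //; apply/next/(inv_next inv).
- move=> u /linkedP[->|[ux uD]]; first by rewrite g'x setU11.
  by rewrite g'E // => lt_gu; apply/setU1r/(inv_pending inv uD)/leqW.
(* Links to vertices not yet passed lead into [A], so none leads to the fresh vertex [y]; this keeps
   [g] injective. *)
- have no_y u : u \in linked x.+1 A g -> g u != y.
    move=> uD; apply: contraNneq yA => def_y; rewrite -def_y.
    by apply: (inv_pending inv uD); rewrite def_y ltnW.
  move=> u u' /linkedP[->|[ux uD]] /linkedP[->|[u'x u'D]] //.
  + by rewrite g'x g'E // => def_y; case/eqP: (no_y _ u'D).
  + by rewrite g'x g'E // => def_y; case/eqP: (no_y _ uD).
  by rewrite !g'E //; apply: (inv_inj inv uD u'D).
- by move=> i' lti'; apply/setU1r/(inv_start inv).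
- move=> u i' /linkedP[->|[ux uD]] lti'; last by rewrite g'E //;
  apply: (inv_start_hit inv uD lti').
  by rewrite g'x => def_y; case/negP: yA; rewrite def_y (inv_start inv).
- exact: inv_tree_step.
Qed.

Lemma step_others i :
  let y := left_nb e x i in
  x != t -> x \notin A -> x \in others g ->
  i < j -> y \notin others g ->
  (forall i', i < i' -> i' < j -> left_nb e x i' \in others g) ->
  sweep_inv x j A [eta g with y |-> x].
Proof.
move=> y xt xA xB ltij yB maxi; set g' := [eta _ with _ |-> _].
have lt_xt : x < t.
  rewrite ltn_neqAle val_eqE xt leqNgt; apply/negP=> lt_tx.
  by have [_ /(_ _ xB)] := inv_early inv (leqW lt_tx); rewrite ltnn.
have [eqB gd] := inv_others inv lt_xt; move: eqB; rewrite belowS xB add1n => eqB.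
have ltd := ldeg_others xB lt_xt xA.
have lti : i < ldeg e x by rewrite (leq_trans ltij) // -eqB.
have lt_yx : y < x by apply: left_nb_lt.
have g'E u : u != y -> g' u = g u by move=> ux; rewrite /= (negbTE ux).
have g'y : g' y = x by rewrite /= eqxx.
have othersE : others g' = y |: others g.
  apply/setP=> u; rewrite !in_setU in_set1 !in_set.
  case: (eqVneq u y) => [->|uy]; last by rewrite g'E.
  by rewrite g'y -lt0n (leq_ltn_trans _ lt_yx).
have linkedP u : u \in linked x A g' -> u = y \/ u != y /\ u \in linked x.+1 A g.
  move=> H; case: (eqVneq u y) => [->|uy]; [by left|right; split=> //]; move: H.
  rewrite !mem_linked othersE in_setU1 (negbTE uy) leq_eqVlt => /andP[-> /=].
  by case: (x =P u :> nat) => [/val_inj<-|//]; rewrite (negbTE xA) /= andbF.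
(* A link to [x] would have put [x] into [A] by [inv_pending], so the new link to [x] is the only
   one. *)
have no_x u : u \in linked x.+1 A g -> g u != x.
  move=> uD; apply: contraNneq xA => def_x; rewrite -def_x.
  by apply: (inv_pending inv uD); rewrite def_x.
split; try by [case: inv].
- exact: ltnW lt_xs.
- by rewrite -inv_split (negbTE xA) addn0.
- exact: inv_goodx.
- rewrite othersE below_setU1 // lt_yx add1n => _; split=> //.
  by apply: good_advance => //; [lia|move=> i' lti' ?; apply: maxi => //; lia].
- by move=> lt_tx; have := ltn_trans lt_tx lt_xt; rewrite ltnn.
- move=> u; rewrite othersE => /setU1P[->|]; last exact: (inv_others_lt inv).
  rewrite (ltn_trans lt_yx lt_xs); split=> //.
  by rewrite -val_eqE ltn_eqF // (ltn_trans lt_yx).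
- move=> u /linkedP[->|[uy uD]]; last by rewrite g'E //; apply: (inv_edge inv uD).
  by rewrite g'y (proj1 e_simple) left_nb_edge.
- move=> u /linkedP[->|[uy uD]].
    by rewrite g'y othersE !in_setU xB !orbT.
  rewrite g'E //; have := inv_next inv uD; rewrite othersE !in_setU.
  by case/or3P=> ->; rewrite ?orbT.
- move=> u /linkedP[->|[uy uD]]; first by rewrite g'y ltnn.
  by rewrite g'E // => lt_gu; apply/(inv_pending inv uD)/leqW.
- move=> u u' /linkedP[->|[uy uD]] /linkedP[->|[u'y u'D]] //.
  + by rewrite g'y g'E // => def_x; case/eqP: (no_x _ u'D).
  + by rewrite g'y g'E // => def_x; case/eqP: (no_x _ uD).
  by rewrite !g'E //; apply: (inv_inj inv uD u'D).
- move=> u i' /linkedP[->|[uy uD]] lti'; last by rewrite g'E //;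
  apply: (inv_start_hit inv uD lti').
  by rewrite g'y => def_x; case/negP: xA; rewrite def_x (inv_start inv).
- exact: inv_tree_step.
Qed.

Lemma step_target :
  let j' := below A x in
  x = t ->
  sweep_inv x j' A (fun u => if u \in left_nbs e x j' then x else g u).
Proof.
move=> j' def_x; set g' := fun u => _.
have [ltd xT] := inv_goodx.1 x (leqnn x).
have [eqjk gtB] := inv_early inv (eq_leq (congr1 S (congr1 val (esym def_x)))).
have ltL u : u \in left_nbs e x j' -> u < x by apply: left_nbs_lt.
have othersE : others g' = left_nbs e x j' :|: others g.
  apply/setP=> u; rewrite in_setU [LHS]in_set /g'; case: ifPn => uL;
    last by rewrite in_set.
  by rewrite -lt0n (leq_ltn_trans _ (ltL _ uL)).
have othersN u : u < x -> u \notin others g.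
  by move=> ltu; apply/negP=> /gtB; rewrite ltnNge ltnW.
have linkedP u : u \in linked x A g' ->
    (u \in left_nbs e x j') \/ u \notin left_nbs e x j' /\ u \in linked x.+1 A g.
  move=> H; case: (boolP (u \in left_nbs e x j')) => [|uL]; [by left|right;
    split=> //]; move: H.
  rewrite !mem_linked othersE in_setU (negbTE uL) leq_eqVlt -def_x => /andP[ux].
  by rewrite ux eq_sym val_eqE (negbTE ux).
have g'E u : u \notin left_nbs e x j' -> g' u = g u by move=> uL;
  rewrite /g' (negbTE uL).
have g'x u : u \in left_nbs e x j' -> g' u = x by move=> uL; rewrite /g' uL.
split; try by [case: inv].
- exact: ltnW lt_xs.
- by have := inv_leq inv; have := inv_split; rewrite -/j'; lia.
- exact: inv_goodx.
- move=> _; have eqL (z : 'I_n) : z < x -> (z \in left_nbs e x j') = (z \in others g').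
    by move=> ltz; rewrite othersE in_setU (negbTE (othersN z ltz)) orbF.
  split; last exact: good_eq eqL (good_left_nbs e_simple e_mao ltd xT).
  by rewrite -(eq_below eqL) left_nbs_count // nb_before_self //; apply/minn_idPl.
- by rewrite def_x ltnn.
- move=> u; rewrite othersE in_setU => /orP[/ltL ltu|]; last exact: (inv_others_lt inv).
  by rewrite (ltn_trans ltu lt_xs) -def_x -val_eqE ltn_eqF.
- move=> u /linkedP[uL|[uL uD]]; last by rewrite g'E //; apply: (inv_edge inv uD).
  rewrite g'x //; case/(left_nbsP _ ltd): uL => i lti ->.
  by rewrite (proj1 e_simple) left_nb_edge // (leq_trans lti).
- move=> u /linkedP[uL|[uL uD]]; first by rewrite g'x // def_x setU11.
  rewrite g'E //; have := inv_next inv uD; rewrite othersE !in_setU.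
  by case/or3P=> ->; rewrite ?orbT.
- move=> u /linkedP[uL|[uL uD]]; first by rewrite g'x // ltnn.
  by rewrite g'E // => lt_gu; apply/(inv_pending inv uD)/leqW.
- move=> u u' /linkedP[uL|[uL uD]] /linkedP[u'L|[u'L u'D]].
  + by rewrite (g'x u) // def_x eqxx.
  + by rewrite (g'x u) // def_x eqxx.
  + by rewrite (g'x u') // => ->; rewrite def_x eqxx.
  by rewrite !g'E //; apply: (inv_inj inv uD u'D).
- move=> u i' /linkedP[uL|[uL uD]] lti'; first by rewrite g'x // def_x.
  by rewrite g'E //; apply: (inv_start_hit inv uD lti').
- exact: inv_tree_step.
Qed.

End Step.
End Sweep.

(** * Following the links *)

Section Walk.

Variables (T : finType) (D : {set T}) (g : T -> T) (t : T) (k : nat) (a : nat -> T).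
Hypotheses (tD : t \notin D) (gD : forall u, u \in D -> g u \in t |: D).
Hypothesis g_inj : forall u u', u \in D -> u' \in D -> g u = g u' -> g u != t -> u = u'.
Hypotheses (aD : forall i, i < k -> a i \in t |: D)
  (a_inj : forall i i', i < k -> i' < k -> a i = a i' -> i = i')
  (a_hit : forall u i, u \in D -> i < k -> g u = a i -> g u = t).

(** Before reaching [t] a walk visits distinct elements of [D], so [#|D|.+1] terms suffice. If [t]
    were absent, [index] would return [#|D|.+1], which [walk_end] refutes. *)
Definition steps i : nat := index t (traject g (a i) #|D|.+1).

Definition walk i : seq T := mkseq (fun m => iter m g (a i)) (steps i).+1.

Lemma walk_in i m : i < k -> m < steps i -> iter m g (a i) \in D.
Proof.
move=> ltik lt_m.
have neq_t : iter m g (a i) != t.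
  have := before_find (a i) lt_m; rewrite nth_traject => [/= -> //|].
  by apply: leq_trans lt_m _; rewrite -(size_traject g (a i) #|D|.+1) index_size.
suff: iter m g (a i) \in t |: D by rewrite in_setU1 (negbTE neq_t).
elim: m lt_m {neq_t} => [|m IHm] lt_m; first exact: aD.
have := IHm (ltnW lt_m); rewrite in_setU1 => /predU1P[eq_t|]; last exact: gD.
have := before_find (a i) (ltnW lt_m); rewrite nth_traject /= ?eq_t ?eqxx //.
by apply: leq_trans (ltnW lt_m) _; rewrite -(size_traject g (a i) #|D|.+1) index_size.
Qed.

(** Injectivity of [g] traces a common vertex back along both walks until one of them is at its
    start; by [a_hit] no link that precedes [t] enters a start, so both are. *)
Lemma walk_inj i i' m m' :
  i < k -> i' < k -> m < steps i -> m' < steps i' ->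
  iter m g (a i) = iter m' g (a i') -> i = i' /\ m = m'.
Proof.
move=> ltik lti'k; elim: m m' => [|m IHm] [|m'] lt_m lt_m' eq_it.
- by split=> //; apply: a_inj.
- have := a_hit (walk_in lti'k (ltnW lt_m')) ltik (esym eq_it).
  by move=> eq_t; have := walk_in lti'k lt_m'; rewrite iterS eq_t (negbTE tD).
- have := a_hit (walk_in ltik (ltnW lt_m)) lti'k eq_it.
  by move=> eq_t; have := walk_in ltik lt_m; rewrite iterS eq_t (negbTE tD).
suff: iter m g (a i) = iter m' g (a i') by case/(IHm _ (ltnW lt_m) (ltnW lt_m')) =>
  -> ->.
apply: g_inj eq_it _; try exact/walk_in/ltnW.
by apply: contraNneq tD => <-; apply: walk_in lt_m.
Qed.

Lemma walk_end i : i < k -> iter (steps i) g (a i) = t.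
Proof.
move=> ltik; have t_in : t \in traject g (a i) #|D|.+1.
  apply: contraT => tN; have eq_st : steps i = #|D|.+1.
    by have := memNindex tN; rewrite size_traject.
  have : uniq (mkseq (fun m => iter m g (a i)) #|D|.+1).
    apply/mkseq_uniqP => m m'; rewrite !inE -eq_st => lt_m lt_m'.
    by case/(walk_inj ltik ltik lt_m lt_m').
  move=> /card_uniqP; rewrite size_mkseq => eq_card.
  suff: #|D|.+1 <= #|D| by rewrite ltnn.
  rewrite -eq_card; apply/subset_leq_card/subsetP => u /mapP[m].
  by rewrite mem_iota -eq_st => lt_m ->; apply: walk_in.
have lt_st : steps i < #|D|.+1.
  by rewrite -[X in _ < X](size_traject g (a i)) index_mem.
by rewrite -(nth_traject g lt_st (a i)) nth_index.
Qed.

Lemma sum_steps : sumn [seq steps i | i <- iota 0 k] <= #|D|.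
Proof.
pose w := [seq iter m g (a i) | i <- iota 0 k, m <- iota 0 (steps i)].
have uniq_w : uniq w.
  apply: allpairs_uniq_dep => [|i _|]; rewrite ?iota_uniq //.
  move=> _ _ /allpairsPdep[i [m [+ + ->]]] /allpairsPdep[i' [m' [+ + ->]]] /=.
  rewrite !mem_iota => ltik lt_m lti'k lt_m' eq_it.
  by have [-> ->] := walk_inj ltik lti'k lt_m lt_m' eq_it.
have -> : sumn [seq steps i | i <- iota 0 k] = #|w|.
  rewrite (card_uniqP uniq_w) size_allpairs_dep; congr sumn.
  by apply: eq_map => i; rewrite size_iota.
apply/subset_leq_card/subsetP => _ /allpairsPdep[i [m [+ + ->]]].
by rewrite !mem_iota; apply: walk_in.
Qed.

Lemma mem_walk i u : i < k -> u \in walk i -> u \in t |: D.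
Proof.
move=> ltik /mapP[m]; rewrite mem_iota add0n leq0n ltnS leq_eqVlt =>
  /predU1P[->|lt_m] ->.
  by rewrite walk_end // setU11.
exact/setU1r/walk_in.
Qed.

Lemma walk_uniq i : i < k -> uniq (walk i).
Proof.
move=> ltik; rewrite /walk mkseqS rcons_uniq walk_end //; apply/andP; split.
  by apply: contra tD => /mapP[m]; rewrite mem_iota => lt_m ->; apply: walk_in.
apply/mkseq_uniqP => m m'; rewrite !inE => lt_m lt_m'.
by case/(walk_inj ltik ltik lt_m lt_m').
Qed.

Lemma last_walk i : i < k -> last (a i) (walk i) = t.
Proof. by move=> ltik; rewrite /walk mkseqS last_rcons walk_end. Qed.

Lemma walk_disjoint i i' u :
  i < k -> i' < k -> u \in walk i -> u \in walk i' -> u != t -> i = i'.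
Proof.
have walkP l : l < k -> u \in walk l -> u != t ->
    exists2 m, m < steps l & u = iter m g (a l).
  move=> ltlk /mapP[m]; rewrite mem_iota add0n leq0n ltnS leq_eqVlt =>
    /predU1P[->|lt_m] ->.
    by rewrite walk_end // eqxx.
  by exists m.
move=> ltik lti'k ui ui' ut.
have [m lt_m eq_u] := walkP _ ltik ui ut; have [m' lt_m' eq_u'] := walkP _ lti'k ui' ut.
by have [] := walk_inj ltik lti'k lt_m lt_m' (etrans (esym eq_u) eq_u').
Qed.

End Walk.

(** * The paths given by the final links *)

Section Paths.

Variables (n : nat) (e : rel 'I_n) (s t : 'I_n) (k : nat).
Hypotheses (le_k : k <= ldeg e s) (lt_ts : t < s).
Variables (c : nat) (A : {set 'I_n}) (g : 'I_n -> 'I_n).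
Hypotheses (inv : sweep_inv e s t k c 0 A g) (k_gt0 : 0 < k).

Let D := linked t c A g.
Let a i := left_nb e s i.

(** With no open path left, no element of [A] lies below [c]: all of them have been passed and carry
    a link, except possibly [t]. *)
Lemma ends_linked u : u \in t |: (A :|: others g) -> u \in t |: D.
Proof.
rewrite !in_setU1 in_setU => /predU1P[->|]; first by rewrite eqxx.
case: eqP => //= /eqP ut /orP[uA|uB]; rewrite mem_linked ut ?uB ?orbT // uA andbT.
rewrite leqNgt; apply/orP; left; apply/negP => /(below_gt0 uA).
by rewrite (inv_below inv).
Qed.

Let tD : t \notin D. Proof. by rewrite mem_linked eqxx. Qed.

Let gD u : u \in D -> g u \in t |: D.
Proof. by move=> uD; apply/ends_linked/(inv_next inv). Qed.

Let g_inj u u' : u \in D -> u' \in D -> g u = g u' -> g u != t -> u = u'.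
Proof. exact: (inv_inj inv). Qed.

Let aD i : i < k -> a i \in t |: D.
Proof. by move=> ltik; apply: ends_linked; rewrite !inE (inv_start inv) ?orbT. Qed.

Let a_inj i i' : i < k -> i' < k -> a i = a i' -> i = i'.
Proof. by move=> lti lti'; apply: left_nb_inj; apply: leq_trans le_k. Qed.

Let a_hit u i : u \in D -> i < k -> g u = a i -> g u = t.
Proof. exact: (inv_start_hit inv). Qed.

Lemma linked_interval u : u \in D -> c <= u < s.
Proof.
rewrite mem_linked => /andP[_ /orP[/andP[-> /(inv_lt inv)] //|uB]].
have [-> _] := inv_others_lt inv uB; rewrite andbT leqNgt.
apply/negP => /(below_gt0 uB); rewrite (inv_others inv _).1 //.
(* The sweep did reach [t], as otherwise all [k] paths would still be open. *)
by rewrite leqNgt; apply: contraL k_gt0 => /(inv_early inv)[<-].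
Qed.

(** Every vertex strictly between [c] and [s] has a positive share. The extra 1 is for [c], where
    the last path may have closed. *)
Lemma card_linked : #|D| <= (\sum_u tree_ldeg e s k u).+1.
Proof.
pose x := Ordinal (leq_ltn_trans (inv_le inv) (ltn_ord s)).
pose I := [set u : 'I_n | c < u < s].
have leI : #|I| <= \sum_u tree_ldeg e s k u.
  rewrite -sum1_card big_mkcond; apply: leq_sum => u _.
  by rewrite inE; case: ifP => // /andP[? ?]; apply: (inv_tree inv).
have: #|D| <= #|x |: I|.
  apply/subset_leq_card/subsetP => u /linked_interval/andP[le_cu lt_us].
  by rewrite !inE lt_us andbT -val_eqE /= eq_sym -leq_eqVlt.
by move=> leD; apply: (leq_trans leD); rewrite cardsU1 -add1n leq_add ?leq_b1.
Qed.

Lemma out_steps_end i : i < k -> iter (steps D g t a i) g (a i) = t.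
Proof. exact: (walk_end tD gD g_inj aD a_inj a_hit). Qed.

Lemma out_steps_neq i m : i < k -> m < steps D g t a i -> iter m g (a i) != t.
Proof. by move=> ltik ltm; apply: contraNneq tD => <-; apply: (walk_in gD aD). Qed.

Lemma sum_out_steps : sumn [seq steps D g t a i | i <- iota 0 k] <= #|D|.
Proof. exact: (sum_steps tD gD g_inj aD a_inj a_hit). Qed.

Definition out_paths : seq (seq 'I_n) :=
  [seq s :: walk D g t a i | i <- iota 0 k].

Lemma out_paths_disjoint : internally_disjoint_paths e s t out_paths.
Proof.
have sD : s \notin t |: D.
  rewrite in_setU1 negb_or -val_eqE gtn_eqF //=.
  by apply/negP => /linked_interval; rewrite ltnn andbF.
have mem_w i u : i < k -> u \in walk D g t a i -> u \in t |: D.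
  exact: mem_walk.
split.
- rewrite map_inj_in_uniq ?iota_uniq // => i i'; rewrite !mem_iota => ltik lti'k.
  by move=> [/(a_inj ltik lti'k)].
- move=> _ /mapP[i + ->]; rewrite mem_iota => ltik.
  rewrite /is_path_between; apply/and4P; split; first exact: eqxx.
  + apply/(pathP s) => -[|m]; rewrite size_mkseq => lt_m.
      exact: (left_nb_edge (leq_trans ltik le_k)).
    rewrite -[nth s (s :: _) _]/(nth s (walk D g t a i) m).
    rewrite !nth_mkseq ?(ltnW lt_m) //.
    exact: (inv_edge inv (walk_in gD aD ltik lt_m)).
  + by apply/eqP; exact: (last_walk tD gD g_inj aD a_inj a_hit ltik).
  rewrite cons_uniq; apply/andP; split; last exact: (walk_uniq tD gD g_inj aD a_inj
    a_hit ltik).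
  by apply: contra sD; apply: (mem_w i).
- move=> _ _ /mapP[i + ->] /mapP[i' + ->]; rewrite !mem_iota => ltik lti'k ne_pq u.
  rewrite !in_cons => /predU1P[->|ui]; first by left.
  case/predU1P=> [->|ui']; first by left.
  right; apply/eqP; apply: contraNT ne_pq => ut.
  by rewrite (walk_disjoint tD gD g_inj aD a_inj a_hit ltik lti'k ui ui' ut).
Qed.

End Paths.

(** * The program *)

(* Beyond the arrays 0-4 of the specification, array 5 marks the ends of the
   paths from [s], array 6 holds the links [g], and arrays 7-11 are the scalars
   v (the position of the sweep), j, i, the length of the output, and u. *)
Definition var (a : nat) : expr := Cell a (Const 0).
Definition src : expr := Cell 0 (Const 1).
Definition tgt : expr := Cell 0 (Const 2).
Definition num : expr := Cell 0 (Const 3).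
Definition nb_at_i (x : expr) : expr := Cell 2 (Add (Cell 1 x) (var 9)).
(** Subtraction is truncated, so at least one summand is 0, and the sum is the absolute
    difference. *)
Definition differ (x y : expr) : expr := Add (Defs.Sub x y) (Defs.Sub y x).

Definition assign (a : nat) (x : expr) : program := Store a (Const 0) x.
Definition incr (a : nat) : program := assign a (Add (var a) (Const 1)).
Definition decr (a : nat) : program := assign a (Defs.Sub (var a) (Const 1)).
Definition emit (x : expr) : program := Seq (Store 4 (var 10) x) (incr 10).

Definition mark_loop : program :=
  While (Defs.Sub num (var 9)) (Seq (Store 5 (nb_at_i src) (Const 1)) (incr 9)).

Definition link_loop : program :=
  While (Defs.Sub (var 8) (var 9)) (Seq (Store 6 (nb_at_i (var 7)) (var 7)) (incr 9)).

(** No test for [i] running out is made: [advance_exists] guarantees that the descent stops at a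
    free neighbour. *)
Definition find_loop (a : nat) : program :=
  While (Cell a (nb_at_i (var 7))) (decr 9).

Definition find_free (a : nat) : program :=
  Seq (assign 9 (Defs.Sub (var 8) (Const 1))) (find_loop a).

Definition advance_marked : program :=
  Seq (find_free 5)
      (Seq (Store 6 (var 7) (nb_at_i (var 7))) (Store 5 (nb_at_i (var 7)) (Const 1))).

Definition advance_linked : program :=
  Seq (find_free 6) (Store 6 (nb_at_i (var 7)) (var 7)).

Definition start_target : program :=
  Seq (If (Cell 5 (var 7)) (decr 8) Skip) (Seq (assign 9 (Const 0)) link_loop).

Definition sweep_step : program :=
  Seq (decr 7)
      (If (differ (var 7) tgt)
          (If (Cell 5 (var 7))
              (If (Cell 6 (var 7)) (decr 8) advance_marked)
              (If (Cell 6 (var 7)) advance_linked Skip))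
          start_target).

Definition sweep : program := While (var 8) sweep_step.

Definition follow_loop : program :=
  While (differ (var 11) tgt) (Seq (assign 11 (Cell 6 (var 11))) (emit (var 11))).

Definition emit_path : program :=
  Seq (Store 3 (var 9) (var 10))
      (Seq (emit src) (Seq (assign 11 (nb_at_i src)) (Seq (emit (var 11))
        follow_loop))).

Definition output_loop : program :=
  While (Defs.Sub num (var 9)) (Seq emit_path (incr 9)).

Definition disjoint_paths_program : program :=
  Seq (assign 7 src)
      (Seq (assign 8 num)
      (Seq mark_loop
      (Seq sweep
      (Seq (assign 9 (Const 0))
      (Seq output_loop (Store 3 (var 9) (var 10))))))).

Lemma nth_upd_rcons (q : seq nat) (x c : nat) :
  nth 0 (rcons q x) c = if c == size q then x else nth 0 q c.
Proof.
rewrite nth_rcons; case: ltngtP => // lt_qc.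
by rewrite nth_default // ltnW.
Qed.

Lemma sumn_leq (b : nat) (r : seq nat) : all (leq^~ b) r -> sumn r <= b * size r.
Proof. by elim: r => //= x r IHr /andP[lex /IHr]; rewrite mulnS; lia. Qed.

(** * Correctness and running time of the program *)

Section Program.

Variables (n : nat) (e : rel 'I_n).
Hypotheses (e_simple : simple_graph e) (e_mao : max_adj_ordering e).
Variables (s t : 'I_n) (k w : nat).
Hypotheses (le_k : k <= ldeg e s) (lt_ts : t < s) (tT : in_tree e s k t).
Hypotheses (k_gt0 : 0 < k) (w_big : 8 * n ^ 2 <= 2 ^ w).

Let n_gt1 : 1 < n. Proof. by have := ltn_ord s; lia. Qed.

Let small x : x < 8 * n ^ 2 -> x %% 2 ^ w = x.
Proof. by move=> ltx; rewrite modn_small // (leq_trans ltx). Qed.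

(** Two distinct vertices force [n > 1], so that [8 * n ^ 2] is at least 32. *)
Let small_const c : c < 32 -> c %% 2 ^ w = c.
Proof. by move=> ltc; apply: small; nia. Qed.

Implicit Types (A B : {set 'I_n}) (g h : 'I_n -> 'I_n) (os q : seq nat).

Definition scalar (x c : nat) : nat := if c == 0 then x else 0.

(** The memory in terms of the data of the sweep. Array 10 is tied to the length of the output [q],
    and cells standing for no vertex are 0, so that the input is an instance. *)
Definition mem (A : {set 'I_n}) (g : 'I_n -> 'I_n) (os q : seq nat) (v j i u : nat) :
  state :=
  fun a c => match a with
  | 0 | 1 | 2 => input e s t k a c
  | 3 => nth 0 os c
  | 4 => nth 0 q c
  | 5 => if insub c is Some x then nat_of_bool (x \in A) else 0
  | 6 => if insub c is Some x then val (g x) else 0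
  | 7 => scalar v c
  | 8 => scalar j c
  | 9 => scalar i c
  | 10 => scalar (size q) c
  | 11 => scalar u c
  | _ => 0
  end.

Lemma eq_mem A A' g g' os q v j i u :
  A =i A' -> g =1 g' -> mem A g os q v j i u =2 mem A' g' os q v j i u.
Proof.
move=> eqA eqg [|[|[|[|[|[|[|a]]]]]]] c //=.
  by case: insub => // x; rewrite eqA.
by case: insub => // x; rewrite eqg.
Qed.

Lemma input_mem (z : 'I_n) : z = 0 :> nat ->
  input e s t k =2 mem set0 (fun _ => z) [::] [::] 0 0 0 0.
Proof.
move=> z0; have sc c : scalar 0 c = 0 by rewrite /scalar; case: ifP.
case=> [|[|[|a]]] c //; rewrite /input [nth [::] _ _]nth_default // nth_nil.
case: a => [|[|[|[|[|[|[|[|[|a]]]]]]]]] /=; rewrite ?sc ?nth_nil //.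
  by case: insub => // x; rewrite in_set0.
by case: insub.
Qed.

Section State.

Variables (A : {set 'I_n}) (g : 'I_n -> 'I_n) (os q : seq nat) (v j i u : nat).
Let m := mem A g os q v j i u.

Lemma eval_const c : c < 32 -> eval w m (Const c) = c.
Proof. exact: small_const. Qed.

Lemma eval_var m0 a : eval w m0 (var a) = m0 a 0.
Proof. by rewrite /= mod0n. Qed.

Lemma eval_u : eval w m (var 11) = u.
Proof. exact: eval_var. Qed.

Lemma eval_src : eval w m src = s.
Proof. by rewrite /= small_const. Qed.

Lemma eval_tgt : eval w m tgt = t.
Proof. by rewrite /= small_const. Qed.

Lemma eval_num : eval w m num = k.
Proof. by rewrite /= small_const. Qed.

Lemma eval_differ x y (a b : 'I_n) :
  eval w m x = a -> eval w m y = b -> (eval w m (differ x y) != 0) = (a != b).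
Proof.
move=> ex ey; rewrite [eval w m _]/= ex ey small; last first.
  by have := ltn_ord a; have := ltn_ord b; nia.
by rewrite -val_eqE /=; lia.
Qed.

Lemma eval_mark x (y : 'I_n) : eval w m x = y -> eval w m (Cell 5 x) = (y \in A).
Proof. by move=> ex; rewrite /= ex valK. Qed.

Lemma eval_link x (y : 'I_n) : eval w m x = y -> eval w m (Cell 6 x) = g y.
Proof. by move=> ex; rewrite /= ex valK. Qed.

(** The address computed is a position in the concatenated rows, whose total length is at most
    [n ^ 2]; hence the addition does not wrap. *)
Lemma eval_nb x (y : 'I_n) :
  eval w m x = y -> i < ldeg e y -> eval w m (nb_at_i x) = left_nb e y i.
Proof.
move=> ex lti; have [nb_i lti'] := nth_neighbours lti.
set rows := vertex_rows [seq neighbours e z | z <- enum 'I_n].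
have size_rows : size rows = n by rewrite /rows /vertex_rows 2!size_map size_enum_ord.
have nth_rows : nth [::] rows y = [seq val z | z <- neighbours e y].
  have lt_y : y < size (enum 'I_n) by rewrite size_enum_ord.
  rewrite (nth_map [::]); last by rewrite size_map.
  by rewrite (nth_map y) // nth_ord_enum.
have off : nth 0 (offsets rows) y = sumn (take y (shape rows)).
  by rewrite (nth_map 0) ?size_iota ?size_rows ?ltnS 1?ltnW // nth_iota ?size_rows //
    ltnS ltnW.
have -> : eval w m (nb_at_i x) =
    nth 0 (flatten rows) ((nth 0 (offsets rows) y + i) %% 2 ^ w).
  by rewrite /= ex mod0n.
have shape_y : nth 0 (shape rows) y = size (neighbours e y).
  by rewrite nth_shape nth_rows size_map.
have in_flat : sumn (take y (shape rows)) + i < size (flatten rows).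
  by rewrite size_flatten; apply: flatten_indexP; rewrite shape_y.
have flat_small : size (flatten rows) < 8 * n ^ 2.
  have : sumn (shape rows) <= n * size (shape rows).
    apply: sumn_leq; rewrite /shape !all_map; apply/allP => z _ /=.
    by rewrite size_map size_filter -[X in _ <= X](size_enum_ord n) count_size.
  rewrite size_flatten size_map size_rows; nia.
rewrite off small; last exact: ltn_trans flat_small.
rewrite -[_ + i]/(flatten_index (shape rows) y i) nth_flatten.
by rewrite flatten_indexKl ?flatten_indexKr ?shape_y // nth_rows (nth_map y) // nb_i.
Qed.

Lemma run_v x x' : eval w m x = x' ->
  runs w (assign 7 x) m (expr_cost x + 5) (mem A g os q x' j i u).
Proof.
move=> <-; apply: runs_store => [|]; first by rewrite /=; lia.
rewrite [eval w m (Const 0)]/= mod0n.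
by move=> a c; rewrite /update; do 12?[case: a => [|a] //=]; rewrite /scalar;
  case: (c == 0).
Qed.

Lemma run_j x x' : eval w m x = x' ->
  runs w (assign 8 x) m (expr_cost x + 5) (mem A g os q v x' i u).
Proof.
move=> <-; apply: runs_store => [|]; first by rewrite /=; lia.
rewrite [eval w m (Const 0)]/= mod0n.
by move=> a c; rewrite /update; do 12?[case: a => [|a] //=]; rewrite /scalar;
  case: (c == 0).
Qed.

Lemma run_i x x' : eval w m x = x' ->
  runs w (assign 9 x) m (expr_cost x + 5) (mem A g os q v j x' u).
Proof.
move=> <-; apply: runs_store => [|]; first by rewrite /=; lia.
rewrite [eval w m (Const 0)]/= mod0n.
by move=> a c; rewrite /update; do 12?[case: a => [|a] //=]; rewrite /scalar;
  case: (c == 0).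
Qed.

Lemma run_u x x' : eval w m x = x' ->
  runs w (assign 11 x) m (expr_cost x + 5) (mem A g os q v j i x').
Proof.
move=> <-; apply: runs_store => [|]; first by rewrite /=; lia.
rewrite [eval w m (Const 0)]/= mod0n.
by move=> a c; rewrite /update; do 12?[case: a => [|a] //=]; rewrite /scalar;
  case: (c == 0).
Qed.

Lemma eval_todo : eval w m (Defs.Sub num (var 9)) = k - i.
Proof. by rewrite /= mod0n small_const. Qed.

Lemma eval_links_todo : eval w m (Defs.Sub (var 8) (var 9)) = j - i.
Proof. by rewrite /= !mod0n. Qed.

Lemma eval_pred a : eval w m (Defs.Sub (var a) (Const 1)) = (m a 0).-1.
Proof. by rewrite /= mod0n small_const // subn1. Qed.

Lemma eval_succ a : (m a 0).+1 < 8 * n ^ 2 ->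
  eval w m (Add (var a) (Const 1)) = (m a 0).+1.
Proof. by move=> lta; rewrite /= mod0n (@small_const 1) // small addn1. Qed.

Lemma run_mark x (y : 'I_n) : eval w m x = y ->
  runs w (Store 5 x (Const 1)) m (expr_cost x + 5) (mem (y |: A) g os q v j i u).
Proof.
move=> ex; apply: runs_store => [|]; first by rewrite /=; lia.
rewrite ex eval_const //.
move=> a c; rewrite /update; do 12?[case: a => [|a] //=].
case: insubP => [z _ <-|]; first by rewrite val_eqE in_setU1; case: eqP.
by case: eqP => // ->; rewrite ltn_ord.
Qed.

Lemma run_link x z (y y' : 'I_n) : eval w m x = y -> eval w m z = y' ->
  runs w (Store 6 x z) m (expr_cost x + expr_cost z + 5)
    (mem A [eta g with y |-> y'] os q v j i u).
Proof.
move=> ex ez; apply: runs_store => [|]; first by rewrite /=; lia.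
rewrite ex ez.
move=> a c; rewrite /update; do 12?[case: a => [|a] //=].
case: insubP => [z' _ <-|]; first by rewrite val_eqE; case: eqP.
by case: eqP => // ->; rewrite ltn_ord.
Qed.

Lemma run_emit x z : eval w m x = z -> (size q).+1 < 8 * n ^ 2 ->
  runs w (emit x) m (expr_cost x + 20) (mem A g os (rcons q z) v j i u).
Proof.
move=> ex ltq; have run1 : runs w (Store 4 (var 10) x) m (expr_cost x + 5) (update m
  4 (size q) z).
  by apply: runs_store => [|a c]; [rewrite /=; lia|rewrite ex eval_var].
have run2 : runs w (incr 10) (update m 4 (size q) z) 15 (mem A g os (rcons q z) v j i
  u).
  apply: runs_store => //; rewrite /= !mod0n (@small_const 1) // /update /= small
    ?addn1 //.
  move=> a c; do 12?[case: a => [|a] //=]; rewrite ?nth_upd_rcons //.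
  by rewrite /scalar size_rcons; case: (c == 0).
by apply: runs_weaken (runs_seq run1 run2) _ _ => //; lia.
Qed.

Lemma run_offset : size os = i ->
  runs w (Store 3 (var 9) (var 10)) m 10 (mem A g (rcons os (size q)) q v j i u).
Proof.
move=> size_os; apply: runs_store => //; rewrite !eval_var.
by move=> a c; rewrite /update; do 12?[case: a => [|a] //=];
  rewrite nth_upd_rcons size_os.
Qed.

End State.

Lemma run_incr_i A g os q v j i u : i < n ->
  runs w (incr 9) (mem A g os q v j i u) 10 (mem A g os q v j i.+1 u).
Proof.
move=> lti; have lti2 : i.+1 < 8 * n ^ 2 by nia.
exact: runs_weaken (run_i (eval_succ _)) _ _.
Qed.

Lemma run_decr_i A g os q v j i u :
  runs w (decr 9) (mem A g os q v j i u) 10 (mem A g os q v j i.-1 u).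
Proof. by apply: runs_weaken (run_i (eval_pred _ _ _ _ _ _ _ _ _)) _ _. Qed.

Lemma run_decr_j A g os q v j i u :
  runs w (decr 8) (mem A g os q v j i u) 10 (mem A g os q v j.-1 i u).
Proof. by apply: runs_weaken (run_j (eval_pred _ _ _ _ _ _ _ _ _)) _ _. Qed.

Lemma ldeg_leq x : ldeg e x <= n.
Proof. by rewrite -nb_before_self // -[X in _ <= X]card_ord max_card. Qed.

Lemma left_nbsS x i : i < ldeg e x -> left_nbs e x i.+1 = left_nb e x i |: left_nbs e
  x i.
Proof.
move=> lti; apply/setP=> y; rewrite in_setU1 !in_set.
by rewrite (take_nth x) // mem_rcons in_cons.
Qed.

Lemma run_mark_loop g os q v j u d i : d + i = k ->
  runs w mark_loop (mem (left_nbs e s i) g os q v j i u) (50 * d + 10)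
    (mem (left_nbs e s k) g os q v j k u).
Proof.
elim: d i => [|d IHd] i eqk.
  rewrite -eqk add0n; apply: runs_while_false => //.
  by rewrite eval_todo -eqk subnn.
have lti : i < ldeg e s by lia.
have ltin : i < n by have := ldeg_leq s; lia.
apply: (@runs_weaken w _ _ (expr_cost (Defs.Sub num (var 9)) + (20 + 10) + (50 * d +
  10)).+1);
  [|by rewrite /=; lia|by []].
have eqk' : d + i.+1 = k by lia.
apply: runs_while_true _ _ (IHd _ eqk').
  by rewrite eval_todo; lia.
apply: runs_seq _ (run_incr_i ltin).
apply: runs_weaken (run_mark (eval_nb _ lti)) _ _ => //; first exact: eval_src.
by apply: eq_mem => // y; rewrite left_nbsS.
Qed.

Lemma run_link_loop A g os q j (x : 'I_n) u d i : d + i = j -> j <= ldeg e x ->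
  runs w link_loop
    (mem A (fun y => if y \in left_nbs e x i then x else g y) os q x j i u) (50 * d +
      10)
    (mem A (fun y => if y \in left_nbs e x j then x else g y) os q x j j u).
Proof.
move=> + lej; elim: d i => [|d IHd] i eqj.
  rewrite -eqj add0n; apply: runs_while_false => //.
  by rewrite eval_links_todo subnn.
have lti : i < ldeg e x by lia.
have ltin : i < n by have := ldeg_leq x; lia.
apply: (@runs_weaken w _ _ (expr_cost (Defs.Sub (var 8) (var 9)) + (20 + 10) + (50 *
  d + 10)).+1);
  [|by rewrite /=; lia|by []].
have eqj' : d + i.+1 = j by lia.
apply: runs_while_true _ _ (IHd _ eqj').
  by rewrite eval_links_todo; lia.
apply: runs_seq _ (run_incr_i ltin).
apply: runs_weaken (run_link (eval_nb _ lti) _) _ _ => //; try exact: eval_var.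
by apply: eq_mem => // y; rewrite left_nbsS // in_setU1 /=; case: eqP.
Qed.

Lemma run_find_loop a A g os q v j u i0 d :
  (forall i, i0 < i -> i <= d + i0 ->
     eval w (mem A g os q v j i u) (Cell a (nb_at_i (var 7))) != 0) ->
  eval w (mem A g os q v j i0 u) (Cell a (nb_at_i (var 7))) = 0 ->
  runs w (find_loop a) (mem A g os q v j (d + i0) u) (50 * d + 10)
    (mem A g os q v j i0 u).
Proof.
move=> nz z; elim: d nz => [|d IHd] nz.
  by apply: runs_while_false.
apply: (@runs_weaken w _ _ (expr_cost (Cell a (nb_at_i (var 7))) + 10 + (50 * d +
  10)).+1);
  [|by rewrite /=; lia|by []].
have nz' i : i0 < i -> i <= d + i0 ->
    eval w (mem A g os q v j i u) (Cell a (nb_at_i (var 7))) != 0.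
  by move=> lti lei; apply: nz => //; lia.
apply: runs_while_true _ _ (IHd nz'); last exact: run_decr_i.
by apply: nz; lia.
Qed.

Lemma run_find_free a A g os q (x : 'I_n) j i u i0 :
  i0 < j ->
  (forall i, i0 < i -> i < j ->
     eval w (mem A g os q x j i u) (Cell a (nb_at_i (var 7))) != 0) ->
  eval w (mem A g os q x j i0 u) (Cell a (nb_at_i (var 7))) = 0 ->
  runs w (find_free a) (mem A g os q x j i u) (50 * j + 30) (mem A g os q x j i0 u).
Proof.
move=> lt_i0 nz z; have [d def_j] : exists d, j.-1 = d + i0.
  by exists (j.-1 - i0); lia.
have nz' i' : i0 < i' -> i' <= d + i0 ->
    eval w (mem A g os q x j i' u) (Cell a (nb_at_i (var 7))) != 0.
  by move=> lti lei; apply: nz => //; lia.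
have run1 : runs w (assign 9 (Defs.Sub (var 8) (Const 1))) (mem A g os q x j i u) 9
    (mem A g os q x j (d + i0) u).
  by apply: run_i; rewrite eval_pred -?def_j.
by apply: runs_weaken (runs_seq run1 (run_find_loop nz' z)) _ _ => //=; lia.
Qed.

Lemma run_advance_marked A g os q (x : 'I_n) j i u i0 :
  i0 < j -> j <= ldeg e x -> left_nb e x i0 \notin A ->
  (forall i, i0 < i -> i < j -> left_nb e x i \in A) ->
  runs w advance_marked (mem A g os q x j i u) (50 * j + 100)
    (mem (left_nb e x i0 |: A) [eta g with x |-> left_nb e x i0] os q x j i0 u).
Proof.
move=> lt_i0 lej yA maxi; have lt_d := leq_trans lt_i0 lej.
have eval_x B h i' : eval w (mem B h os q x j i' u) (var 7) = x by rewrite eval_var.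
have run1 : runs w (find_free 5) (mem A g os q x j i u) (50 * j + 30) (mem A g os q x
  j i0 u).
  apply: run_find_free => // [i' lti' ltj|].
    by rewrite (eval_mark (eval_nb (eval_x _ _ _) (leq_trans ltj lej))) maxi.
  by rewrite (eval_mark (eval_nb (eval_x _ _ _) lt_d)) (negbTE yA).
have run2 := run_link (eval_x A g i0) (eval_nb (eval_x A g i0) lt_d).
have run3 := run_mark (eval_nb (eval_x A [eta g with x |-> left_nb e x i0] i0) lt_d).
by apply: runs_weaken (runs_seq run1 (runs_seq run2 run3)) _ _ => //=; lia.
Qed.

Lemma run_advance_linked A g os q (x : 'I_n) j i u i0 :
  i0 < j -> j <= ldeg e x -> left_nb e x i0 \notin others g ->
  (forall i, i0 < i -> i < j -> left_nb e x i \in others g) ->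
  runs w advance_linked (mem A g os q x j i u) (50 * j + 100)
    (mem A [eta g with left_nb e x i0 |-> x] os q x j i0 u).
Proof.
move=> lt_i0 lej yB maxi; have lt_d := leq_trans lt_i0 lej.
have eval_x B h i' : eval w (mem B h os q x j i' u) (var 7) = x by rewrite eval_var.
have run1 : runs w (find_free 6) (mem A g os q x j i u) (50 * j + 30) (mem A g os q x
  j i0 u).
  apply: run_find_free => // [i' lti' ltj|].
    rewrite (eval_link (eval_nb (eval_x _ _ _) (leq_trans ltj lej))).
    by have := maxi i' lti' ltj; rewrite in_set.
  rewrite (eval_link (eval_nb (eval_x _ _ _) lt_d)).
  by move: yB; rewrite in_set negbK => /eqP.
have run2 := run_link (eval_nb (eval_x A g i0) lt_d) (eval_x A g i0).
by apply: runs_weaken (runs_seq run1 run2) _ _ => //=; lia.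
Qed.

Lemma run_start_target A g os q (x : 'I_n) j i u (j' := j - (x \in A)) :
  j' <= ldeg e x ->
  runs w start_target (mem A g os q x j i u) (50 * j' + 50)
    (mem A (fun y => if y \in left_nbs e x j' then x else g y) os q x j' j' u).
Proof.
move=> lej'; have eval_x : eval w (mem A g os q x j i u) (var 7) = x by rewrite
  eval_var.
have run1 : runs w (If (Cell 5 (var 7)) (decr 8) Skip) (mem A g os q x j i u) 20
    (mem A g os q x j' i u).
  apply: (@runs_weaken w _ _ (expr_cost (Cell 5 (var 7)) + 10).+1) => //.
  apply: runs_if; rewrite (eval_mark eval_x) /j'; case: (x \in A) => /=.
    by rewrite subn1; apply: run_decr_j.
  by rewrite subn0; apply: runs_skip.
have run2 := run_i (eval_const A g os q x j' i u (isT : 0 < 32)).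
have run3 : runs w link_loop (mem A g os q x j' 0 u) (50 * j' + 10)
    (mem A (fun y => if y \in left_nbs e x j' then x else g y) os q x j' j' u).
  apply: runs_pre _ (run_link_loop (addn0 j') lej').
  by apply: eq_mem => // y; rewrite in_set take0.
by apply: runs_weaken (runs_seq run1 (runs_seq run2 run3)) _ _ => //=; lia.
Qed.

(** The bound uses [j'], the count after the step, because that is what [x] can pay: the new
    invariant puts [x] into [T_j'] with at least [j'] left neighbours. *)
Lemma run_sweep_step (x : 'I_n) j A g os q i u :
  sweep_inv e s t k x.+1 j A g -> 0 < j ->
  exists j' A' g' i', sweep_inv e s t k x j' A' g' /\
    runs w sweep_step (mem A g os q x.+1 j i u) (50 * j' + 200)
      (mem A' g' os q x j' i' u).
Proof.
move=> inv j_gt0.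
pose m := mem A g os q x j i u.
have eval_x : eval w m (var 7) = x by rewrite eval_var.
have run0 : runs w (decr 7) (mem A g os q x.+1 j i u) 10 m.
  by apply: runs_weaken (run_v (eval_pred _ _ _ _ _ _ _ _ _)) _ _.
(* The tests are accounted for once, for all five branches. *)
have branch p1 C A' g' j' i' (m' := mem A' g' os q x j' i' u) :
    C <= 50 * j' + 150 -> runs w p1 m C m' ->
    (if x != t then
      if x \in A then if x \in others g then p1 = decr 8 else p1 = advance_marked
      else if x \in others g then p1 = advance_linked else p1 = Skip
     else p1 = start_target) ->
    runs w sweep_step (mem A g os q x.+1 j i u) (50 * j' + 200) m'.
  move=> leB run1 def_p1.
  have run2 : runs w (If (differ (var 7) tgt)
          (If (Cell 5 (var 7))
              (If (Cell 6 (var 7)) (decr 8) advance_marked)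
              (If (Cell 6 (var 7)) advance_linked Skip))
          start_target) m (C + 40) m'.
    apply: (@runs_weaken w _ _ (expr_cost (differ (var 7) tgt) + (C + 20)).+1) =>
      //=; last by lia.
    apply: runs_if; rewrite (eval_differ eval_x (eval_tgt _ _ _ _ _ _ _ _)).
    case: ifP def_p1 => [_|_ <-]; last by apply: runs_weaken run1 _ _ => //; lia.
    move=> def_p1.
    apply: (@runs_weaken w _ _ (expr_cost (Cell 5 (var 7)) + (C + 10)).+1) => //=;
      last by lia.
    apply: runs_if; rewrite (eval_mark eval_x) eqb0 negbK.
    have link_x : (eval w m (Cell 6 (var 7)) != 0) = (x \in others g).
      by rewrite (eval_link eval_x) in_set.
    by case: ifP def_p1 => _ def_p1;
      apply: (@runs_weaken w _ _ (expr_cost (Cell 6 (var 7)) + C).+1) => //=; try lia;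
      apply: runs_if; rewrite link_x; case: ifP def_p1 => _ <-.
  by apply: runs_weaken (runs_seq run0 run2) _ _ => //; lia.
have eqj := inv_split inv.
case: (eqVneq x t) branch => [xt|xt] branch.
  pose j' := below A x; have [led _] := (inv_goodx inv).1 x (leqnn x).
  have def_j' : j - (x \in A) = j' by rewrite -eqj addnK.
  have run1 : runs w start_target m (50 * j' + 50)
      (mem A (fun y => if y \in left_nbs e x j' then x else g y) os q x j' j' u).
    by rewrite -def_j'; apply: run_start_target; rewrite def_j'.
  exists j', A, (fun y => if y \in left_nbs e x j' then x else g y), j'; split.
    exact: (step_target e_simple e_mao le_k lt_ts tT k_gt0 inv j_gt0 xt).
  by apply: (branch _ _ _ _ _ _ _ run1) => //; lia.
case: (boolP (x \in A)) branch => xA; case: (boolP (x \in others g)) => xB branch.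
- exists j.-1, A, g, i; split; first exact: (step_meet e_simple e_mao le_k lt_ts tT
  k_gt0 inv j_gt0 xt xA xB).
  by apply: (branch _ _ _ _ _ _ _ (@run_decr_j A g os q x j i u)) => //=; lia.
- have ltd := ldeg_A e_simple e_mao tT k_gt0 inv xt xA xB.
  have [i0 [lei0 yA maxi]] := advance_exists xA ltd.
  have def_j : j = (below A x).+1 by rewrite -eqj xA addn1.
  have maxi' i' : i0 < i' -> i' < j -> left_nb e x i' \in A by rewrite def_j;
    apply: maxi.
  have lt_i0 : i0 < j by rewrite def_j.
  exists j, (left_nb e x i0 |: A), [eta g with x |-> left_nb e x i0], i0; split.
    exact: (step_A e_simple e_mao le_k lt_ts tT k_gt0 inv j_gt0 xt xA xB lt_i0 yA
      maxi').
  have lej : j <= ldeg e x by rewrite def_j.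
  by apply: (branch _ _ _ _ _ _ _ (run_advance_marked lt_i0 lej yA maxi')) => //; lia.
- have lt_xt : x < t.
    rewrite ltn_neqAle val_eqE xt leqNgt; apply/negP=> lt_tx.
    by have [_ /(_ _ xB)] := inv_early inv (leqW lt_tx); rewrite ltnn.
  have ltd := ldeg_others inv xB lt_xt xA.
  have [i0 [lei0 yB maxi]] := advance_exists xB ltd.
  have def_j : j = (below (others g) x).+1.
    by have [<- _] := inv_others inv lt_xt; rewrite belowS xB.
  have maxi' i' : i0 < i' -> i' < j -> left_nb e x i' \in others g.
    by rewrite def_j; apply: maxi.
  have lt_i0 : i0 < j by rewrite def_j.
  exists j, A, [eta g with left_nb e x i0 |-> x], i0; split.
    exact: (step_others e_simple e_mao le_k lt_ts tT k_gt0 inv j_gt0 xt xA xB lt_i0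
      yB maxi').
  have lej : j <= ldeg e x by rewrite def_j.
  by apply: (branch _ _ _ _ _ _ _ (run_advance_linked lt_i0 lej yB maxi')) => //; lia.
exists j, A, g, i; split; first exact: (step_skip e_simple e_mao inv j_gt0 xt xA xB).
by apply: (branch _ _ _ _ _ _ _ (@runs_skip w m 1 isT)) => //; lia.
Qed.

Lemma run_sweep v j A g os q i u :
  sweep_inv e s t k v j A g -> 0 < j ->
  exists v' A' g' i', sweep_inv e s t k v' 0 A' g' /\
    runs w sweep (mem A g os q v j i u)
      (300 * (\sum_(x : 'I_n | x < v) tree_ldeg e s k x) + 300)
      (mem A' g' os q v' 0 i' u).
Proof.
elim: v j A g i => [|v IHv] j A g i inv j_gt0.
  (* No end lies below position 0, so the paths are closed before the vertices run out. *)
  have := inv_below inv; rewrite /below => def_j.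
  by move: j_gt0; rewrite -def_j card_gt0 => /set0Pn[x]; rewrite inE ltn0 andbF.
pose x := Ordinal (ltn_trans (inv_le inv) (ltn_ord s)).
have [j' [A' [g' [i1 [inv' run1]]]]] := run_sweep_step (x := x) os q i u inv j_gt0.
have nz m : m 8 0 = j -> eval w m (var 8) != 0 by move=> mj; rewrite eval_var mj -lt0n.
have sumS : \sum_(y : 'I_n | y < v.+1) tree_ldeg e s k y =
    tree_ldeg e s k x + \sum_(y : 'I_n | y < v) tree_ldeg e s k y.
  rewrite (bigD1 x) //=; congr (_ + _); apply: eq_bigl => y.
  by rewrite ltnS -val_eqE /= ltn_neqAle andbC.
have [j'0|j'_gt0] := posnP j'.
  rewrite j'0 in inv' run1; exists v, A', g', i1; split=> //.
  have run2 : runs w sweep (mem A' g' os q v 0 i1 u) 10 (mem A' g' os q v 0 i1 u).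
    by apply: runs_while_false; rewrite ?eval_var.
  apply: runs_weaken (runs_while_true _ run1 run2) _ _ => //; first exact: nz.
  by rewrite /=; lia.
have [v2 [A2 [g2 [i2 [inv2 run2]]]]] := IHv _ _ _ i1 inv' j'_gt0.
exists v2, A2, g2, i2; split=> //.
apply: runs_weaken (runs_while_true _ run1 run2) _ _ => //; first exact: nz.
(* As [j' > 0], the share of [x] is positive and also covers the constant part of the cost. The last
   step, with [j' = 0], is covered by the additive 300. *)
have [led xT] := (inv_good inv').1 x (leqnn v); rewrite (inv_below inv') in led xT.
have := tree_ldeg_geq e_simple e_mao (inv_leq inv') xT led.
by rewrite sumS /=; lia.
Qed.

Lemma run_follow_loop A g os q v j i (y : 'I_n) d :
  iter d g y = t -> (forall l, l < d -> iter l g y != t) ->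
  size q + d < 8 * n ^ 2 ->
  runs w follow_loop (mem A g os q v j i y) (100 * d + 30)
    (mem A g os (q ++ [seq val z | z <- traject g (g y) d]) v j i t).
Proof.
elim: d y q => [|d IHd] y q.
  move=> /= -> _ _; rewrite cats0; apply: runs_while_false => //.
  by apply/eqP; rewrite -[_ == _]negbK (eval_differ (eval_u _ _ _ _ _ _ _ _)
    (eval_tgt _ _ _ _ _ _ _ _)) eqxx.
move=> def_t neq_t small_q.
have run1 : runs w (assign 11 (Cell 6 (var 11))) (mem A g os q v j i y) 10
    (mem A g os q v j i (g y)).
  by apply: runs_weaken (run_u (eval_link (eval_u _ _ _ _ _ _ _ _))) _ _.
have run2 : runs w (emit (var 11)) (mem A g os q v j i (g y)) 30
    (mem A g os (rcons q (g y)) v j i (g y)).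
  by apply: runs_weaken (run_emit (eval_u _ _ _ _ _ _ _ _) _) _ _ => //; lia.
have run3 := IHd (g y) (rcons q (g y)).
rewrite -iterSr in run3; have {}run3 := run3 def_t.
apply: runs_weaken (runs_while_true _ (runs_seq run1 run2) (run3 _ _)) _ _.
- by rewrite (eval_differ (eval_u _ _ _ _ _ _ _ _) (eval_tgt _ _ _ _ _ _ _ _)) (neq_t
  0).
- by move=> l ltl; rewrite -iterSr; apply: neq_t.
- by rewrite size_rcons; lia.
- by rewrite /=; lia.
by rewrite cat_rcons.
Qed.

(** * Writing out the paths *)

Section Output.

Variables (c : nat) (A : {set 'I_n}) (g : 'I_n -> 'I_n).
Hypothesis inv : sweep_inv e s t k c 0 A g.

Let D := linked t c A g.
Let path_steps i := steps D g t (left_nb e s) i.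
Let rows := vertex_rows (out_paths e s t k c A g).
Let offs i := [seq sumn (take l (shape rows)) | l <- iota 0 i].
Let flat i := flatten (take i rows).

Lemma size_rows : size rows = k.
Proof. by rewrite !size_map size_iota. Qed.

Lemma nth_rows i : i < k -> nth [::] rows i =
  [seq val z | z <- [:: s, left_nb e s i & traject g (g (left_nb e s i)) (path_steps
    i)]].
Proof.
move=> ltik; rewrite (nth_map [::]) ?size_map ?size_iota //.
rewrite (nth_map 0) ?size_iota // nth_iota // add0n; congr (map _ (_ :: _)).
apply: (@eq_from_nth _ s) => [|l]; rewrite size_mkseq /= ?size_traject // => ltl.
by rewrite nth_mkseq // -trajectS (set_nth_default (left_nb e s i)) ?size_traject //
  nth_traject.
Qed.

Lemma flatS i : i < k -> flat i.+1 = flat i ++ nth [::] rows i.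
Proof.
by move=> ltik; rewrite /flat (take_nth [::]) ?size_rows // flatten_rcons.
Qed.

Lemma size_flat i : size (flat i) = sumn (take i (shape rows)).
Proof. by rewrite size_flatten /shape map_take. Qed.

Lemma offsS i : offs i.+1 = rcons (offs i) (size (flat i)).
Proof. by rewrite /offs -addn1 iotaD map_cat cats1 size_flat. Qed.

(** Inner vertices of the paths are distinct elements of [D]; each path adds its ends [s] and [t].
    This keeps the output positions within the word size. *)
Lemma size_flat_leq i : i < k -> size (flat i) + size (nth [::] rows i) <= #|D| + 2 * k.
Proof.
move=> ltik; rewrite -size_cat -flatS // size_flat.
have -> : shape rows = [seq (path_steps l).+2 | l <- iota 0 k].
  apply: (@eq_from_nth _ 0) => [|l]; rewrite ?size_map ?size_iota // => ltl.
  rewrite nth_shape (nth_map 0) ?size_iota // nth_iota // nth_rows //.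
  by rewrite size_map /= size_traject.
rewrite -map_take take_iota.
apply: (@leq_trans (sumn [seq path_steps l | l <- iota 0 k] + 2 * k)); last first.
  rewrite leq_add2r; exact: (sum_out_steps le_k inv).
have sum2 r : sumn [seq (path_steps l).+2 | l <- r] =
    sumn [seq path_steps l | l <- r] + 2 * size r.
  by elim: r => //= l r ->; lia.
have def_k := subnKC (geq_minr i.+1 k).
rewrite sum2 size_iota -[X in _ <= sumn (map _ (iota 0 X)) + _]def_k.
by rewrite iotaD map_cat sumn_cat; lia.
Qed.

Lemma run_emit_path i v j u : i < k ->
  runs w emit_path (mem A g (offs i) (flat i) v j i u) (100 * path_steps i + 200)
    (mem A g (offs i.+1) (flat i.+1) v j i t).
Proof.
move=> ltik; have ltd := leq_trans ltik le_k.
have := size_flat_leq ltik; rewrite nth_rows // size_map /= size_traject => leq_size.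
have leD : #|D| <= n by rewrite -[X in _ <= X]card_ord max_card.
have lek : k <= n := leq_trans le_k (ldeg_leq s).
have lt_n : 3 * n < 8 * n ^ 2 by nia.
have small_size : size (flat i) + (path_steps i).+2 < 8 * n ^ 2.
  apply: leq_ltn_trans lt_n; apply: (leq_trans leq_size).
  by rewrite -[3]/(1 + 2) mulnDl mul1n leq_add ?leq_mul.
set y := left_nb e s i in leq_size small_size *.
have run1 : runs w (Store 3 (var 9) (var 10)) (mem A g (offs i) (flat i) v j i u) 10
    (mem A g (offs i.+1) (flat i) v j i u).
  by rewrite offsS; apply: run_offset; rewrite size_map size_iota.
have run2 : runs w (emit src) (mem A g (offs i.+1) (flat i) v j i u) 30
    (mem A g (offs i.+1) (rcons (flat i) s) v j i u).
  by apply: runs_weaken (run_emit (eval_src _ _ _ _ _ _ _ _) _) _ _ => //; lia.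
have run3 : runs w (assign 11 (nb_at_i src)) (mem A g (offs i.+1) (rcons (flat i) s)
  v j i u) 20
    (mem A g (offs i.+1) (rcons (flat i) s) v j i y).
  by apply: runs_weaken (run_u (eval_nb (eval_src _ _ _ _ _ _ _ _) ltd)) _ _.
have run4 : runs w (emit (var 11)) (mem A g (offs i.+1) (rcons (flat i) s) v j i y) 30
    (mem A g (offs i.+1) (rcons (rcons (flat i) s) y) v j i y).
  by apply: runs_weaken (run_emit (eval_u _ _ _ _ _ _ _ _) _) _ _ => //;
    rewrite size_rcons; lia.
have run5 : runs w follow_loop (mem A g (offs i.+1) (rcons (rcons (flat i) s) y) v j
  i y)
    (100 * path_steps i + 30) (mem A g (offs i.+1) (flat i.+1) v j i t).
  rewrite flatS // nth_rows // -cat_rcons -cat_rcons; apply: run_follow_loop.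
  - exact: (out_steps_end le_k inv).
  - by move=> l; apply: (out_steps_neq inv).
  - by rewrite !size_rcons; lia.
have run := runs_seq run1 (runs_seq run2 (runs_seq run3 (runs_seq run4 run5))).
by apply: runs_weaken run _ _ => //; lia.
Qed.

Lemma run_output_loop d i v j u : d + i = k ->
  exists u', runs w output_loop (mem A g (offs i) (flat i) v j i u)
    (300 * d + 100 * sumn [seq path_steps l | l <- iota i d] + 10)
    (mem A g (offs k) (flat k) v j k u').
Proof.
elim: d i u => [|d IHd] i u eqk.
  exists u; rewrite -eqk add0n; apply: runs_while_false => //.
  by rewrite eval_todo -eqk subnn.
have ltik : i < k by lia.
have ltin : i < n := leq_trans ltik (leq_trans le_k (ldeg_leq s)).
have eqk' : d + i.+1 = k by lia.
have [u' run2] := IHd i.+1 t eqk'; exists u'.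
apply: runs_weaken (runs_while_true _ (runs_seq (run_emit_path ltik) (run_incr_i
  ltin)) run2) _ _ => //.
  by rewrite eval_todo; lia.
by rewrite /=; lia.
Qed.

Lemma flat0 : flat 0 = [::]. Proof. by rewrite /flat take0. Qed.

Lemma flat_all : flat k = flatten rows.
Proof. by rewrite /flat -[X in take X]size_rows take_size. Qed.

Lemma offsets_rows : offsets rows = offs k.+1.
Proof. by rewrite /offsets size_rows. Qed.

Lemma run_output i v j u : exists i' u',
  runs w (Seq (assign 9 (Const 0)) (Seq output_loop (Store 3 (var 9) (var 10))))
    (mem A g [::] [::] v j i u) (300 * k + 100 * #|D| + 50)
    (mem A g (offsets rows) (flatten rows) v j i' u').
Proof.
have run1 := run_i (eval_const A g [::] [::] v j i u (isT : 0 < 32)).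
have [u' run2] := run_output_loop v j u (addn0 k); exists k, u'.
rewrite flat0 in run2.
have run3 : runs w (Store 3 (var 9) (var 10)) (mem A g (offs k) (flat k) v j k u') 10
    (mem A g (offs k.+1) (flat k) v j k u').
  by rewrite offsS; apply: run_offset; rewrite size_map size_iota.
rewrite -flat_all offsets_rows.
apply: runs_weaken (runs_seq run1 (runs_seq run2 run3)) _ _ => //.
have : sumn [seq path_steps l | l <- iota 0 k] <= #|D| by exact: (sum_out_steps le_k
  inv).
by move: (sumn _) #|D| => S d leS; rewrite /=; lia.
Qed.

End Output.

Lemma run_program : exists c A g v i u,
  sweep_inv e s t k c 0 A g /\
  (let rows := vertex_rows (out_paths e s t k c A g) in
   runs w disjoint_paths_program (input e s t k) (2000 * #|union_tree_edges e k s|)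
     (mem A g (offsets rows) (flatten rows) v 0 i u)).
Proof.
pose z := Ordinal (leq_ltn_trans (leq0n s) (ltn_ord s)).
pose g0 := fun _ : 'I_n => z.
have run1 : runs w (assign 7 src) (input e s t k) 10 (mem set0 g0 [::] [::] s 0 0 0).
  apply: runs_pre (@input_mem z erefl) _.
  by apply: runs_weaken (run_v (eval_src _ _ _ _ _ _ _ _)) _ _.
have run2 : runs w (assign 8 num) (mem set0 g0 [::] [::] s 0 0 0) 10
    (mem set0 g0 [::] [::] s k 0 0).
  by apply: runs_weaken (run_j (eval_num _ _ _ _ _ _ _ _)) _ _.
have run3 : runs w mark_loop (mem set0 g0 [::] [::] s k 0 0) (50 * k + 10)
    (mem (left_nbs e s k) g0 [::] [::] s k k 0).
  apply: runs_pre (run_mark_loop (addn0 k)).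
  by apply: eq_mem => // y; rewrite !inE take0.
have inv0 := sweep_inv0 e_simple e_mao le_k lt_ts (erefl : z = 0 :> nat).
have [c [A [g [i [inv run4]]]]] := run_sweep [::] [::] k 0 inv0 k_gt0.
have [i' [u run5]] := run_output inv i c 0 0.
exists c, A, g, c, i', u; split=> // rows.
have run := runs_seq run1 (runs_seq run2 (runs_seq run3 (runs_seq run4 run5))).
apply: (runs_weaken run) => //.
have le_sum := sum_tree_ldeg e s k.
have leD := card_linked inv k_gt0.
have leS : \sum_(x : 'I_n | x < s) tree_ldeg e s k x + tree_ldeg e s k s <= \sum_x
  tree_ldeg e s k x.
  rewrite [X in _ <= X](bigID (fun x : 'I_n => x < s)) /= leq_add2l.
  by rewrite (bigD1 s) ?ltnn //= leq_addr.
(* The [k] left edges of [s] pay for the marking and for the cost per path; since [k > 0], the union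
   is nonempty and the constant terms are absorbed as well. *)
have lek : k <= tree_ldeg e s k s.
  by apply: tree_ldeg_geq => //; rewrite /in_tree connect0 orbT.
move: le_sum leD leS lek; set S := \sum_x _; set S' := \sum_(x | _) _; set U := #|_|.
by move: (tree_ldeg _ _ _ _) => d; set D := #|_|; lia.
Qed.

End Program.

(* Words have at least b * log2 n bits. *)
Theorem theorem1 :
  exists (p : program) (b c c' : nat),
    forall (n : nat) (e : rel 'I_n),
      simple_graph e -> max_adj_ordering e ->
    forall (s : 'I_n) (k : nat),
      0 < s -> 0 < k -> k <= size (left_neighbours e s) ->
    forall t : 'I_n,
      t < s -> t \in tree_vertices e k s ->
      (forall w : nat, n ^ b <= 2 ^ w ->
         exists (T : nat) (m' : state) (ps : seq (seq 'I_n)),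
           [/\ exec w p (input e s t k) T m',
               T <= c * #|union_tree_edges e k s|,
               outputs m' ps,
               size ps = k
             & internally_disjoint_paths e s t ps]) /\
      #|union_tree_edges e k s| <= c' * (n + #|edges e|).
Proof.
(* The exponent 5 suffices because [n >= 2] gives [n ^ 5 >= 8 * n ^ 2]. The last constant is 1
   because the trees consist of edges of the graph. *)
exists disjoint_paths_program, 5, 2000, 1 => n e e_simple e_mao s k _ k_gt0 le_k t
  lt_ts tT.
split=> [w w_big|]; last first.
  rewrite mul1n (leq_trans _ (leq_addl _ _)) //.
  apply/subset_leq_card/bigcupsP => i _; apply/subsetP => f.
  rewrite inE => /andP[/imsetP[[u v] + ->] _]; rewrite inE /= => uv.
  apply/imsetP; exists (u, v) => //; rewrite inE /=.
  case/orP: uv => /andP[]; rewrite mem_left_neighbours => /andP[_] // vu _.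
  by rewrite (proj1 e_simple).
have tT' : in_tree e s k t by move: tT; rewrite inE /in_tree => ->; rewrite orbT.
have w_big' : 8 * n ^ 2 <= 2 ^ w.
  apply: leq_trans w_big; rewrite (expnD n 3 2) leq_mul2r.
  by rewrite (@leq_exp2r 2 n 3) ?orbT //; have := ltn_ord s; lia.
have [c [A [g [v [i [u [inv run]]]]]]] :=
  run_program e_simple e_mao le_k lt_ts tT' k_gt0 w_big'.
have [//|T [m' [ex leT eqm']]] := run (input e s t k).
exists T, m', (out_paths e s t k c A g); split; [done|done| | |].
- by split=> l _; rewrite eqm'.
- by rewrite size_map size_iota.
exact: (out_paths_disjoint le_k lt_ts inv).
Qed.
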